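(* Let $(M,c,\sigma)$ be Poincar\'e--Einstein, let $w_0\neq -k,\ k-n$ be a weight and $h_0:=d+2w_0$. Given a global solution $\mathcal A$, of weight $w_0$ and tractor form degree $k$, to the tractor Proca equations $$y\mathcal A=\mathscr I^\star\mathcal A=\widehat{\mathscr D}^\star\mathcal A=\mathscr X^\star\mathcal A=0,$$ a solution of the same equations of weight $-w_0-n$ is $$\overline{\mathcal A}=\sigma^{1-h_0}\mathcal A$$ (on the region where $\sigma\neq0$).
   Context: Conformal conventions. $M$ is a smooth manifold of dimension $d=n+1\ge3$ with boundary $\Sigma$ and conformal class $c$. $\mathcal EM[w]$: conformal densities of weight $w$ (families $\mu_g$, $g\in c$, with $\mu_{\Omega^2g}=\Omega^w\mu_g$); each scale $g\in c$ trivialises them; indices are moved with the conformal metric $\boldsymbol g$. $\mathcal E^kM[w]=\Lambda^kT^*M\otimes\mathcal EM[w]$. In a scale $g$: $\varepsilon,\iota$ are exterior/interior multiplication, $\mathbf d=\varepsilon(\nabla)$, $\boldsymbol\delta=\iota(\nabla)$, $\boldsymbol\Delta=\mathbf d\boldsymbol\delta+\boldsymbol\delta\mathbf d$; $\mathrm{Ric}=(d-2)P+Jg$, $J=P^a{}_a$, and $\mathbb P$ is the endomorphism $P^a{}_b$ extended to forms as a derivation. Poincar\'e--Einstein: $\sigma\in\Gamma\mathcal EM[1]$ is positive in the interior, vanishes exactly on $\Sigma$ with $\nabla\sigma\ne0$ there, and $g^o=\sigma^{-2}\boldsymbol g$ satisfies $\mathrm{Ric}(g^o)=-n g^o$. In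 a scale $g$: $\nu=\nabla\sigma$, $\rho=-\frac1d(\nabla^a\nabla_a\sigma+J\sigma)$. Tractor forms. For $g\in c$, $\mathcal T^kM[w]\cong\mathcal E^{k-1}M[w+k]\oplus\mathcal E^kM[w+k]\oplus\mathcal E^{k-2}M[w+k-2]\oplus\mathcal E^{k-1}M[w+k-2]$; sections are $\mathcal F=(F^+,F,F^{+-},F^-)$ (north, west, east, south slots). Under $\hat g=\Omega^2g$, $\Upsilon=\mathbf d\log\Omega$: $\hat F^+=F^+$, $\hat F=F+\varepsilon(\Upsilon)F^+$, $\hat F^{+-}=F^{+-}-\iota(\Upsilon)F^+$, $\hat F^-=F^-+\frac12(\varepsilon(\Upsilon)\iota(\Upsilon)-\iota(\Upsilon)\varepsilon(\Upsilon))F^+-\iota(\Upsilon)F-\varepsilon(\Upsilon)F^{+-}$. Invariant operators on $\mathcal T^kM[w]$: $\mathscr X^\star\mathcal F=(0,F^+,0,F^{+-})$; $\mathscr I^\star\mathcal F=(-\iota(\nu)F^+-\sigma F^{+-},\ \rho F^++\iota(\nu)F+\sigma F^-,\ \iota(\nu)F^{+-},\ \rho F^{+-}-\iota(\nu)F^-)$; $\mathscr D:\Gamma\mathcal T^kM[w]\to\Gamma\mathcal T^{k+1}M[w-1]$ with slots north: $(d+2w-2)\big((w+k)F-\mathbf dF^+\big)$; west: $(d+2w-2)\mathbf dF$; east: $\big(\boldsymbol\Delta+(w+k-2)(J-2\mathbb P)\big)F^+-2\boldsymbol\delta F+(d+2w)\big(\mathbf dF^{+-}+(w+k-2)F^-\big)$;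 south: $[J-2\mathbb P,\mathbf d]F^+-\big(\boldsymbol\Delta+(w+k)(J-2\mathbb P)\big)F-(d+2w)\mathbf dF^-$. $y:=-(\mathscr I^\star\mathscr D+\mathscr D\mathscr I^\star):\Gamma\mathcal T^kM[w]\to\Gamma\mathcal T^kM[w-1]$. On $\ker\mathscr X^\star$, $\widehat{\mathscr D}^\star(0,A,0,\phi)=(0,\ \boldsymbol\delta A+(d+w-k)\phi,\ 0,\ -\boldsymbol\delta\phi)$. *)

(* Defs.v *)
From mathcomp Require Import all_boot all_order all_algebra.
From mathcomp Require Import all_classical all_reals all_analysis.
Import Order.TTheory GRing.Theory Num.Theory.
Import numFieldNormedType.Exports.

Set Implicit Arguments.
Unset Strict Implicit.
Unset Printing Implicit Defensive.

Local Open Scope classical_set_scope.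
Local Open Scope ring_scope.

Definition basis_vec (R : realType) (n : nat) (a : 'I_n.+1) : 'rV[R]_n.+1 :=
  delta_mx 0 a.

Definition half_space (R : realType) (n : nat) : set 'rV[R]_n.+1 :=
  [set x | 0 <= x 0 ord0].

Fixpoint class_C (R : realType) (n m : nat) (V : set 'rV[R]_n.+1)
    (F : 'rV[R]_n.+1 -> R) : Prop :=
  (forall x, V x -> {for x, continuous F}) /\
  (if m is m'.+1 then
     forall a : 'I_n.+1,
       (forall x, V x -> derivable F x (basis_vec R a)) /\
       class_C m' V (fun x => 'D_(basis_vec R a) F x)
   else True).

(* A topological chart of T with values in the half-space; chart_param is the
   inverse of chart_coord and carries no information outside the image. *)
Record chart (R : realType) (n : nat) (T : topologicalType) := Chart {
  chart_dom : set T;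
  chart_coord : T -> 'rV[R]_n.+1;
  chart_param : 'rV[R]_n.+1 -> T;
  chart_dom_open : open chart_dom;
  chart_image_open : exists2 W : set 'rV[R]_n.+1,
    open W & chart_coord @` chart_dom = W `&` half_space (R:=R) (n:=n);
  chart_coordK : forall p, chart_dom p -> chart_param (chart_coord p) = p;
  chart_coord_continuous : {within chart_dom, continuous chart_coord};
  chart_param_continuous :
    {within chart_coord @` chart_dom, continuous chart_param} }.

Definition chart_image (R : realType) (n : nat) (T : topologicalType)
    (u : chart R n T) : set 'rV[R]_n.+1 := chart_coord u @` chart_dom u.

(* In the chart u, f extends near p to a C^oo function on an open subset of
   R^(n+1); this is smoothness up to the boundary when p is mapped to the
   boundary of the half-space. *)
Definition smooth_at (R : realType) (n : nat) (T : topologicalType)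
    (u : chart R n T) (f : T -> R) (p : T) : Prop :=
  exists (V : set 'rV[R]_n.+1) (F : 'rV[R]_n.+1 -> R),
    [/\ open V, V (chart_coord u p), (forall m, class_C m V F) &
        forall x, V x -> chart_image u x -> F x = f (chart_param u x)].

Record manifold (R : realType) (n : nat) := Manifold {
  point_of : topologicalType;
  chart_idx : Type;
  chart_at : chart_idx -> chart R n point_of;
  manifold_hausdorff : hausdorff_space point_of;
  manifold_countable : @second_countable point_of;
  chart_cover : forall p, exists i, chart_dom (chart_at i) p;
  transition_smooth : forall i j p (a : 'I_n.+1),
    chart_dom (chart_at i) p -> chart_dom (chart_at j) p ->
    smooth_at (chart_at i) (fun q => chart_coord (chart_at j) q 0 a) p }.

Arguments chart_at {R n} _ _.

Definition boundary (R : realType) (n : nat) (M : manifold R n) :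
    set (point_of M) :=
  [set p | exists i, chart_dom (chart_at M i) p /\
                     chart_coord (chart_at M i) p 0 ord0 = 0].

Definition smooth_on (R : realType) (n : nat) (M : manifold R n)
    (U : set (point_of M)) (f : point_of M -> R) : Prop :=
  forall i p, U p -> chart_dom (chart_at M i) p -> smooth_at (chart_at M i) f p.

(* The partial derivative of f in the direction of the a-th coordinate of u:
   the limit of the difference quotients along the points of the image of the
   chart, hence a one-sided derivative in the normal direction at the
   boundary. *)
Definition pd (R : realType) (n : nat) (T : topologicalType)
    (u : chart R n T) (a : 'I_n.+1) (f : T -> R) (p : T) : R :=
  lim ((fun h : R =>
          h^-1 * (f (chart_param u (chart_coord u p + h *: basis_vec R a)) - f p)) @
       within [set h : R | chart_image u (chart_coord u p + h *: basis_vec R a)] 0^').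

Definition grad_at (R : realType) (n : nat) (T : topologicalType)
    (u : chart R n T) (f : T -> R) (p : T) : 'rV[R]_n.+1 :=
  \row_a pd u a f p.

(* Row a, column b: derivative of the b-th coordinate of v along the a-th
   coordinate of u. *)
Definition chart_jacobian (R : realType) (n : nat) (T : topologicalType)
    (u v : chart R n T) (p : T) : 'M[R]_n.+1 :=
  \matrix_(a, b) pd u a (fun q => chart_coord v q 0 b) p.

(* The component at S = {s_1 < ... < s_k} is the coefficient of
   dx^{s_1} /\ ... /\ dx^{s_k}. *)
Definition ext_form (R : realType) (n : nat) : Type :=
  {ffun {set 'I_n.+1} -> R^o}.

Definition unit_form (R : realType) (n : nat) : ext_form R n :=
  [ffun S => if S == finset.set0 then 1 else 0].

Definition koszul_sign (R : realType) (n : nat) (a : 'I_n.+1)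
    (S : {set 'I_n.+1}) : R :=
  (-1) ^+ #|[set b in S | (b < a)%N]%SET|.

(* Exterior multiplication by dx^a, and interior multiplication by d/dx^a. *)
Definition emul_basis (R : realType) (n : nat) (a : 'I_n.+1) (w : ext_form R n) :
    ext_form R n :=
  [ffun S : {set 'I_n.+1} =>
     if a \in S then koszul_sign R a (S :\ a)%SET * w (S :\ a)%SET else 0].

Definition imul_basis (R : realType) (n : nat) (a : 'I_n.+1) (w : ext_form R n) :
    ext_form R n :=
  [ffun S : {set 'I_n.+1} =>
     if a \in S then 0 else koszul_sign R a S * w (a |: S)%SET].

Definition emul (R : realType) (n : nat) (v : 'rV[R]_n.+1) (w : ext_form R n) :
    ext_form R n :=
  \sum_a v 0 a *: emul_basis a w.

(* Interior multiplication by the covector v, whose index is raised with the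
   metric of matrix G. *)
Definition imul (R : realType) (n : nat) (G : 'M[R]_n.+1) (v : 'rV[R]_n.+1)
    (w : ext_form R n) : ext_form R n :=
  \sum_a \sum_b (invmx G a b * v 0 a) *: imul_basis b w.

(* Action on the exterior algebra, as a derivation, of the endomorphism
   w_a |-> P_a^b w_b of covectors, for P a covariant 2-tensor. *)
Definition derivation_action (R : realType) (n : nat) (G P : 'M[R]_n.+1)
    (w : ext_form R n) : ext_form R n :=
  \sum_a \sum_b (P *m invmx G) a b *: emul_basis a (imul_basis b w).

(* The algebra morphism dx^b |-> sum_a J_ab dx^a; enum lists the elements of a
   set of ordinals in increasing order. *)
Definition pull_back (R : realType) (n : nat) (J : 'M[R]_n.+1)
    (w : ext_form R n) : ext_form R n :=
  \sum_(S : {set 'I_n.+1})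
     w S *: foldr (fun b eta => emul (\row_a J a b) eta) (unit_form R n) (enum S).

Definition christoffel (R : realType) (n : nat) (T : topologicalType)
    (u : chart R n T) (G : T -> 'M[R]_n.+1) (c a b : 'I_n.+1) (p : T) : R :=
  2^-1 * \sum_e invmx (G p) c e *
    (pd u a (fun q => G q e b) p + pd u b (fun q => G q e a) p
     - pd u e (fun q => G q a b) p).

Definition ricci (R : realType) (n : nat) (T : topologicalType)
    (u : chart R n T) (G : T -> 'M[R]_n.+1) (p : T) : 'M[R]_n.+1 :=
  let Gam c a b := christoffel u G c a b in
  \matrix_(b, e) \sum_a
    (pd u a (Gam a b e) p - pd u b (Gam a a e) p
     + \sum_f (Gam a a f p * Gam f b e p - Gam a b f p * Gam f a e p)).

Definition metric_trace (R : realType) (n : nat) (G B : 'M[R]_n.+1) : R :=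
  \sum_a \sum_b invmx G a b * B a b.

(* With d = n + 1, J and P are the solution of Ric = (d - 2) P + J g, J = tr P;
   see schouten_spec below. *)
Definition schouten_J (R : realType) (n : nat) (T : topologicalType)
    (u : chart R n T) (G : T -> 'M[R]_n.+1) (p : T) : R :=
  metric_trace (G p) (ricci u G p) / (2 * n%:R).

Definition schouten (R : realType) (n : nat) (T : topologicalType)
    (u : chart R n T) (G : T -> 'M[R]_n.+1) (p : T) : 'M[R]_n.+1 :=
  (n%:R - 1)^-1 *: (ricci u G p - schouten_J u G p *: G p).

Lemma schouten_spec (R : realType) (n : nat) (T : topologicalType)
    (u : chart R n T) (G : T -> 'M[R]_n.+1) (p : T) :
  (2 <= n)%N -> G p \in unitmx -> (G p)^T = G p ->
  ricci u G p
    = (n.+1%:R - 2) *: schouten u G p + schouten_J u G p *: G p /\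
  metric_trace (G p) (schouten u G p) = schouten_J u G p.
Proof.
move=> n2 Gu Gs.
have n1 : (n%:R - 1 : R) != 0.
  by rewrite subr_eq0 (_ : 1 = 1%:R) // eqr_nat; case: n n2 {u G p Gu Gs} => [|[|]].
have trG : metric_trace (G p) (G p) = n.+1%:R.
  have -> : metric_trace (G p) (G p) = \tr (invmx (G p) *m (G p)^T).
    by apply: eq_bigr => a _; rewrite mxE; apply: eq_bigr => b _; rewrite mxE.
  by rewrite Gs mulVmx // mxtrace1.
split.
  rewrite /schouten scalerA (_ : n.+1%:R - 2 = n%:R - 1 :> R); last first.
    by rewrite -natr1 -addrA; congr (_ + _); rewrite -[2]/(1 + 1) opprD addrA subrr add0r.
  by rewrite mulfV // scale1r subrK.
have trL (k l : R) (A B : 'M[R]_n.+1) :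
    metric_trace (G p) (k *: (A - l *: B))
    = k * (metric_trace (G p) A - l * metric_trace (G p) B).
  rewrite /metric_trace mulrBr !mulr_sumr -sumrB; apply: eq_bigr => a _.
  rewrite !mulr_sumr -sumrB; apply: eq_bigr => b _; rewrite !mxE.
  by rewrite mulrCA mulrBr mulrBr; congr (_ * _ - _ * _); rewrite mulrCA.
rewrite /schouten trL trG {1}/schouten_J.
set s := metric_trace _ _.
have n0 : (n%:R : R) != 0 by rewrite pnatr_eq0 -lt0n (leq_trans _ n2).
have -> : s = schouten_J u G p * (2 * n%:R).
  by rewrite /schouten_J -/s mulfVK // mulf_neq0 // pnatr_eq0.
rewrite mulfK ?mulf_neq0 ?pnatr_eq0 -?lt0n ?(leq_trans _ n2) //.
rewrite -mulrBr (_ : 2 * n%:R - n.+1%:R = n%:R - 1 :> R).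
  by rewrite mulrCA mulVf // mulr1.
by rewrite -(natr1 n) mulr_natl mulr2n opprD addrA addrK.
Qed.

Definition nabla (R : realType) (n : nat) (T : topologicalType)
    (u : chart R n T) (G : T -> 'M[R]_n.+1) (a : 'I_n.+1)
    (w : T -> ext_form R n) (p : T) : ext_form R n :=
  ([ffun S => pd u a (fun q => w q S) p] : ext_form R n)
  - \sum_b \sum_c
      christoffel u G c a b p *: emul_basis b (imul_basis c (w p)).

Definition extd (R : realType) (n : nat) (T : topologicalType)
    (u : chart R n T) (G : T -> 'M[R]_n.+1) (w : T -> ext_form R n) :
    T -> ext_form R n :=
  fun p => \sum_a emul_basis a (nabla u G a w p).

(* No minus sign: this is the divergence. *)
Definition codiff (R : realType) (n : nat) (T : topologicalType)
    (u : chart R n T) (G : T -> 'M[R]_n.+1) (w : T -> ext_form R n) :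
    T -> ext_form R n :=
  fun p => \sum_a \sum_b invmx (G p) a b *: imul_basis a (nabla u G b w p).

Definition form_laplacian (R : realType) (n : nat) (T : topologicalType)
    (u : chart R n T) (G : T -> 'M[R]_n.+1) (w : T -> ext_form R n) :
    T -> ext_form R n :=
  fun p => extd u G (codiff u G w) p + codiff u G (extd u G w) p.

Definition J2P (R : realType) (n : nat) (T : topologicalType)
    (u : chart R n T) (G : T -> 'M[R]_n.+1) (w : T -> ext_form R n) :
    T -> ext_form R n :=
  fun p => schouten_J u G p *: w p
    - 2 *: derivation_action (G p) (schouten u G p) (w p).

Definition box_at (R : realType) (n : nat) (T : topologicalType)
    (u : chart R n T) (G : T -> 'M[R]_n.+1) (f : T -> R) (p : T) : R :=
  \sum_a \sum_b invmx (G p) a b *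
    (pd u a (pd u b f) p - \sum_c christoffel u G c a b p * pd u c f p).

(* Fields are given by their components in every chart of the atlas; the values
   of the component functions outside the domain of the chart are
   irrelevant. *)
Definition two_tensor (R : realType) (n : nat) (M : manifold R n) : Type :=
  chart_idx M -> point_of M -> 'M[R]_n.+1.

Definition riemannian (R : realType) (n : nat) (M : manifold R n)
    (g : two_tensor M) : Prop :=
  [/\ forall i p, chart_dom (chart_at M i) p ->
        (g i p)^T = g i p /\
        forall x : 'rV[R]_n.+1, x != 0 -> 0 < (x *m g i p *m x^T) 0 0,
      forall i p a b, chart_dom (chart_at M i) p ->
        smooth_at (chart_at M i) (fun q => g i q a b) p &
      forall i j p, chart_dom (chart_at M i) p -> chart_dom (chart_at M j) p ->
        let Jac := chart_jacobian (chart_at M i) (chart_at M j) p in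
        g i p = Jac *m g j p *m Jac^T].

Definition rescales (R : realType) (n : nat) (M : manifold R n)
    (Om : point_of M -> R) (g gh : two_tensor M) : Prop :=
  [/\ smooth_on setT Om, forall p, 0 < Om p &
      forall i p, chart_dom (chart_at M i) p -> gh i p = (Om p) ^+ 2 *: g i p].

Definition conformal_class (R : realType) (n : nat) (M : manifold R n)
    (c : set (two_tensor M)) : Prop :=
  exists2 g0, riemannian g0 & forall g, c g <-> exists Om, rescales Om g0 g.

Definition density (R : realType) (n : nat) (M : manifold R n) : Type :=
  two_tensor M -> point_of M -> R.

Definition is_density (R : realType) (n : nat) (M : manifold R n)
    (c : set (two_tensor M)) (w : R) (mu : density M) : Prop :=
  (forall g, c g -> smooth_on setT (mu g)) /\
  (forall g gh Om, c g -> c gh -> rescales Om g gh ->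
     forall p, mu gh p = Om p `^ w * mu g p).

Definition poincare_einstein (R : realType) (n : nat) (M : manifold R n)
    (c : set (two_tensor M)) (sigma : density M) : Prop :=
  [/\ conformal_class c,
      is_density c 1 sigma,
      (forall g, c g ->
         (forall p, ~ boundary p -> 0 < sigma g p) /\
         (forall p, sigma g p = 0 <-> boundary p)),
      (forall g, c g -> forall i p, chart_dom (chart_at M i) p -> boundary p ->
         grad_at (chart_at M i) (sigma g) p != 0) &
      (forall g, c g -> forall i p, chart_dom (chart_at M i) p -> ~ boundary p ->
         let go q := (sigma g q ^+ 2)^-1 *: g i q in
         ricci (chart_at M i) go p = - n%:R *: go p)].

Definition rho_at (R : realType) (n : nat) (T : topologicalType)
    (u : chart R n T) (G : T -> 'M[R]_n.+1) (s : T -> R) (p : T) : R :=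
  - (n.+1%:R)^-1 * (box_at u G s p + schouten_J u G p * s p).

Record slots (R : realType) (n : nat) (T : Type) := Slots {
  north : T -> ext_form R n;
  west : T -> ext_form R n;
  east : T -> ext_form R n;
  south : T -> ext_form R n }.

Definition form_field (R : realType) (n : nat) (M : manifold R n) : Type :=
  chart_idx M -> point_of M -> ext_form R n.

(* Smooth differential forms of degree k on the open set U; the only form of
   negative degree is zero. *)
Definition is_form (R : realType) (n : nat) (M : manifold R n)
    (U : set (point_of M)) (k : int) (w : form_field M) : Prop :=
  [/\ forall i p (S : {set 'I_n.+1}), U p -> chart_dom (chart_at M i) p ->
        (#|S| : int) != k -> w i p S = 0,
      forall i p (S : {set 'I_n.+1}), U p -> chart_dom (chart_at M i) p ->
        smooth_at (chart_at M i) (fun q => w i q S) p &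
      forall i j p, U p -> chart_dom (chart_at M i) p -> chart_dom (chart_at M j) p ->
        w i p = pull_back (chart_jacobian (chart_at M i) (chart_at M j) p) (w j p)].

(* The slots of a tractor form, in every scale and every chart. *)
Definition tractor_field (R : realType) (n : nat) (M : manifold R n) : Type :=
  two_tensor M -> chart_idx M -> slots R n (point_of M).

(* Sections over U of T^k M[w].  The slots have weights w + k, w + k,
   w + k - 2, w + k - 2; the powers of Om account for their trivialisations in
   the scales g and gh = Om^2 g. *)
Definition tractor_section (R : realType) (n : nat) (M : manifold R n)
    (c : set (two_tensor M)) (U : set (point_of M)) (k : int) (w : R)
    (F : tractor_field M) : Prop :=
  (forall g, c g ->
     [/\ is_form U (k - 1) (fun i => north (F g i)),
         is_form U k (fun i => west (F g i)),
         is_form U (k - 2) (fun i => east (F g i)) &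
         is_form U (k - 1) (fun i => south (F g i))]) /\
  (forall g gh Om, c g -> c gh -> rescales Om g gh ->
     forall i p, U p -> chart_dom (chart_at M i) p ->
     let Fn := north (F g i) in let Fw := west (F g i) in
     let Fe := east (F g i) in let Fs := south (F g i) in
     let Hn := north (F gh i) in let Hw := west (F gh i) in
     let He := east (F gh i) in let Hs := south (F gh i) in
     let Y := grad_at (chart_at M i) (fun q => ln (Om q)) p in
     let e := emul Y in
     let io := imul (g i p) Y in
     let O1 := Om p `^ (w + k%:~R) in
     let O2 := Om p `^ (w + k%:~R - 2) in
     [/\ Hn p = O1 *: Fn p,
         Hw p = O1 *: (Fw p + e (Fn p)),
         He p = O2 *: (Fe p - io (Fn p)) &
         Hs p = O2 *: (Fs p + 2^-1 *: (e (io (Fn p)) - io (e (Fn p)))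
                       - io (Fw p) - e (Fe p))]).

(* The invariant operators on T^k M[w], computed in a chart u and in the scale
   of metric G; s is the trivialisation of sigma in this scale. *)

Definition Xstar (R : realType) (n : nat) (T : topologicalType)
    (F : slots R n T) : slots R n T :=
  Slots (fun=> 0) (north F) (fun=> 0) (east F).

Definition Istar (R : realType) (n : nat) (T : topologicalType)
    (u : chart R n T) (G : T -> 'M[R]_n.+1) (s : T -> R)
    (F : slots R n T) : slots R n T :=
  let Fn := north F in let Fw := west F in
  let Fe := east F in let Fs := south F in
  let inu (w : T -> ext_form R n) p := imul (G p) (grad_at u s p) (w p) in
  Slots
    (fun p => - inu Fn p - s p *: Fe p)
    (fun p => rho_at u G s p *: Fn p + inu Fw p + s p *: Fs p)
    (fun p => inu Fe p)
    (fun p => rho_at u G s p *: Fe p - inu Fs p).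

Definition Dop (R : realType) (n : nat) (T : topologicalType)
    (u : chart R n T) (G : T -> 'M[R]_n.+1) (k : int) (w : R)
    (F : slots R n T) : slots R n T :=
  let Fn := north F in let Fw := west F in
  let Fe := east F in let Fs := south F in
  let d : R := n.+1%:R in
  let kR : R := k%:~R in
  let dd := extd u G in
  let de := codiff u G in
  let lap := form_laplacian u G in
  let Q := J2P u G in
  Slots
    (fun p => (d + 2 * w - 2) *: ((w + kR) *: Fw p - dd Fn p))
    (fun p => (d + 2 * w - 2) *: dd Fw p)
    (fun p => lap Fn p + (w + kR - 2) *: Q Fn p - 2 *: de Fw p
              + (d + 2 * w) *: (dd Fe p + (w + kR - 2) *: Fs p))
    (fun p => (Q (dd Fn) p - dd (Q Fn) p)
              - (lap Fw p + (w + kR) *: Q Fw p)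
              - (d + 2 * w) *: dd Fs p).

(* y = - (I^* D + D I^* ); I^* preserves the weight and lowers the degree. *)
Definition yop (R : realType) (n : nat) (T : topologicalType)
    (u : chart R n T) (G : T -> 'M[R]_n.+1) (s : T -> R)
    (k : int) (w : R) (F : slots R n T) : slots R n T :=
  let A := Istar u G s (Dop u G k w F) in
  let B := Dop u G (k - 1) w (Istar u G s F) in
  Slots (fun p => - (north A p + north B p))
        (fun p => - (west A p + west B p))
        (fun p => - (east A p + east B p))
        (fun p => - (south A p + south B p)).

(* Only meaningful on the kernel of X^*, where the north and east slots
   vanish. *)
Definition Dhatstar (R : realType) (n : nat) (T : topologicalType)
    (u : chart R n T) (G : T -> 'M[R]_n.+1) (k : int) (w : R)
    (F : slots R n T) : slots R n T :=
  let A := west F in let phi := south F in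
  Slots (fun=> 0)
        (fun p => codiff u G A p + (n.+1%:R + w - k%:~R) *: phi p)
        (fun=> 0)
        (fun p => - codiff u G phi p).

Definition vanishes_on (R : realType) (n : nat) (T : Type) (U : set T)
    (F : slots R n T) : Prop :=
  forall p, U p ->
    [/\ north F p = 0, west F p = 0, east F p = 0 & south F p = 0].

Definition proca_solution (R : realType) (n : nat) (M : manifold R n)
    (c : set (two_tensor M)) (sigma : density M) (U : set (point_of M))
    (k : int) (w : R) (A : tractor_field M) : Prop :=
  tractor_section c U k w A /\
  forall g, c g -> forall i,
    let u := chart_at M i in
    let V := U `&` chart_dom u in
    [/\ vanishes_on V (yop u (g i) (sigma g) k w (A g i)),
        vanishes_on V (Istar u (g i) (sigma g) (A g i)),
        vanishes_on V (Dhatstar u (g i) k w (A g i)) &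
        vanishes_on V (Xstar (A g i))].

Definition nonzero_region (R : realType) (n : nat) (M : manifold R n)
    (c : set (two_tensor M)) (sigma : density M) : set (point_of M) :=
  [set p | forall g, c g -> sigma g p != 0].

Definition scale_tractor (R : realType) (n : nat) (M : manifold R n)
    (sigma : density M) (alpha : R) (A : tractor_field M) : tractor_field M :=
  fun g i =>
    let f p := sigma g p `^ alpha in
    Slots (fun p => f p *: north (A g i) p) (fun p => f p *: west (A g i) p)
          (fun p => f p *: east (A g i) p) (fun p => f p *: south (A g i) p).

(* Main.v *)
Require Import Defs.
From HB Require Import structures.
From mathcomp Require Import all_boot all_order all_algebra.
From mathcomp Require Import all_classical all_reals all_analysis.
From mathcomp Require Import ring.
Import Order.TTheory GRing.Theory Num.Theory.
Import numFieldNormedType.Exports.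

Set Implicit Arguments.
Unset Strict Implicit.
Unset Printing Implicit Defensive.

Local Open Scope classical_set_scope.
Local Open Scope ring_scope.

(** In the kernel of X^* a tractor form is a pair (A, phi) and, off the boundary,
    the tractor Proca equations of weight w amount to
      i(nu) A = - sigma phi,   i(nu) phi = 0,
      delta A = - (d + w - k) phi,   delta phi = 0,
      (h - 2) ((w + k) rho A + i(nu) d A)
        = sigma (Delta A + (w + k) (J - 2 P) A + h d phi),   h = d + 2 w.
    The Einstein equation says that the scale tractor is parallel and of unit
    length: nabla nu = - sigma P - rho g and |nu|^2 + 2 rho sigma = 1. For
    f = sigma^(1 - h0), these two identities and
      Delta (f A) = f Delta A + 2 d (i(df) A) + 2 i(df) d A + (box f) A
                    - 2 (Hess f) . A,
    where the symmetric tensor Hess f acts as a derivation, turn the system of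
    weight w0 for (A, phi) into that of weight - w0 - n for (f A, f phi). *)

(** * Functions of class C^m on open sets *)

(** The exponent comes from a single coefficient. For any power f = sigma^alpha and new weight w0 +
    alpha, the first four equations carry over, and in the last one the terms in d phi, nu /\ phi,
    i(nu) d A and (J - 2 P) A match identically. In the coefficient of A there remains a term |nu|^2
    / sigma, which asks for alpha (h0 + 2 alpha - 2) = alpha (alpha - 1): so alpha = 0 or alpha = 1
    - h0. The second root replaces h by 2 - h, and the terms in rho A then agree as well. The
    Einstein equation is given for sigma^-2 g while the Proca system is written in an arbitrary
    scale g, hence a coordinate computation of the conformal change of the Ricci tensor. All
    calculus takes place where the first chart coordinate is positive, so that [pd] is an ordinary
    partial derivative. As [boundary] only asks for some chart in which that coordinate vanishes,
    sigma > 0 at such points is not immediate; it is deduced from the non-vanishing of nabla sigma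
    on the boundary. *)

Section DerivativeOfComposites.
Variables (R : realType) (V : normedModType R).
Implicit Types (f : V -> R) (x v : V).

(** Only derivability along v is available for f, so the one-variable chain rule is applied to the
    restriction of f to the line through x. *)
Lemma is_derive_comp1 f (g : R -> R) x v (df dg : R) :
  is_derive x v f df -> is_derive (f x) 1 g dg ->
  is_derive x v (g \o f) (dg * df).
Proof.
move=> [fxv <-] [gx <-].
pose l (h : R) := f (h *: v + x).
have l0 : l 0 = f x by rewrite /l scale0r add0r.
have dl : derivable l 0 1 by exact: (derivable1P f x v).1.
have gl : derivable g (l 0) 1 by rewrite l0; exact: gx.
have D (F : V -> R) : 'D_v F x = derive1 (fun h : R => F (h *: v + x)) 0.
  rewrite derive1E /derive; set g1 := fun h => h^-1 *: _.
  set g2 := fun h => h^-1 *: _; suff -> : g1 = g2 by [].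
  by apply/funext => h; rewrite /g1 /g2 /= addr0 scale0r add0r [_%:A]mulr1.
split.
  apply: (derivable1P (g \o f) x v).2; apply/derivable1_diffP.
  exact: (differentiable_comp (f := l) ((derivable1_diffP _ _).1 dl)
    ((derivable1_diffP _ _).1 gl)).
rewrite (D (g \o f)) (D f) (derive1_comp dl gl) l0.
by rewrite derive1E.
Qed.

Lemma is_derive_powR f x v (a df : R) : 0 < f x -> is_derive x v f df ->
  is_derive x v (fun y => f y `^ a) (a * f x `^ (a - 1) * df).
Proof.
by move=> f0 fx; exact: (is_derive_comp1 fx (is_derive1_powR a f0)).
Qed.

End DerivativeOfComposites.

Section ClassC.
Variables (R : realType) (n : nat).
Notation E := 'rV[R]_n.+1.
Implicit Types (V W : set E) (F G : E -> R) (m : nat).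
Local Notation e_ a := (basis_vec R a).

Lemma class_C_continuous m V F x : class_C m V F -> V x ->
  {for x, continuous F}.
Proof. by case: m => [|m] [] FV _; exact: FV. Qed.

Lemma class_C_derivable m V F x a : class_C m.+1 V F -> V x ->
  derivable F x (e_ a).
Proof. by move=> [_ /(_ a)[+ _]]; exact. Qed.

Lemma class_C_derive m V F a : class_C m.+1 V F ->
  class_C m V (fun x => 'D_(e_ a) F x).
Proof. by move=> [_ /(_ a)[]]. Qed.

Lemma class_C_sub m V W F : W `<=` V -> class_C m V F -> class_C m W F.
Proof.
move=> WV; elim: m F => [|m IH] F [Fc FD]; split=> //.
- by move=> x /WV/Fc.
- by move=> x /WV/Fc.
- by move=> a; have [Fa Fb] := FD a; split => [x /WV/Fa //|]; exact: IH.
Qed.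

Lemma class_C_le m V F : class_C m.+1 V F -> class_C m V F.
Proof.
elim: m F => [|m IH] F [Fc FD]; split=> //.
by move=> a; have [Fa Fb] := FD a; split => //; exact: IH.
Qed.

Lemma open_near_eq V F G x : open V -> {in V, F =1 G} -> V x ->
  \forall y \near x, F y = G y.
Proof.
move=> Vo FG Vx; near=> y; apply: FG; rewrite inE.
by near: y; exact: open_nbhs_nbhs.
Unshelve. all: by end_near. Qed.

Lemma near_eq_continuous F G x : (\forall y \near x, F y = G y) ->
  {for x, continuous F} -> {for x, continuous G}.
Proof.
move=> FG Fc; have Gx : F x = G x by exact: nbhs_singleton FG.
have : F @ x --> G x by rewrite -Gx; exact: Fc.
by move=> h; apply: cvg_trans h; exact: (near_eq_cvg (F := nbhs x)).
Qed.

(** Openness of V lets an equality on V pass to derivatives: it makes F and G agree near every point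
    of V. *)
Lemma class_C_eq m V F G : open V -> {in V, F =1 G} ->
  class_C m V F -> class_C m V G.
Proof.
move=> Vo; elim: m F G => [|m IH] F G FG [Fc FD].
  by split=> // x Vx; apply: near_eq_continuous (open_near_eq Vo FG Vx) (Fc _ Vx).
split=> [x Vx|a].
  exact: near_eq_continuous (open_near_eq Vo FG Vx) (Fc _ Vx).
have [Fa Fb] := FD a; split.
  by move=> x Vx; apply: near_eq_derivable (Fa _ Vx); exact: (open_near_eq Vo FG Vx).
apply: IH Fb => x; rewrite inE => Vx; apply: near_eq_derive.
exact: (open_near_eq Vo FG Vx).
Qed.

Lemma class_C_local m V F :
  (forall x, V x -> exists2 W, open W & W x /\ class_C m W F) -> class_C m V F.
Proof.
elim: m F => [|m IH] F FW; split=> //.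
- by move=> x /FW[W _ [Wx [+ _]]]; exact.
- by move=> x /FW[W _ [Wx [+ _]]]; exact.
- move=> a; split; first by move=> x /FW[W _ [Wx FC]]; exact: class_C_derivable FC Wx.
  apply: IH => x /FW[W Wo [Wx FC]]; exists W => //; split => //.
  exact: class_C_derive.
Qed.

Lemma class_C_cst m V (r : R) : class_C m V (fun=> r).
Proof.
elim: m r => [|m IH] r; (split=> [x Vx|]; first exact: cst_continuous) => // a.
split=> [x Vx|]; first exact: derivable_cst.
have -> : (fun x => 'D_(e_ a) (fun=> r) x) = (fun=> 0) :> (E -> R).
  by apply/funext => x; exact: derive_cst.
exact: IH.
Qed.

Lemma class_C_add m V F G : open V ->
  class_C m V F -> class_C m V G -> class_C m V (fun x => F x + G x).
Proof.
move=> Vo; elim: m F G => [|m IH] F G FC GC;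
  (split=> [x Vx|]; first exact: (continuousD
    (class_C_continuous FC Vx) (class_C_continuous GC Vx))) => // a.
have dF x (Vx : V x) := class_C_derivable (a:=a) FC Vx.
have dG x (Vx : V x) := class_C_derivable (a:=a) GC Vx.
split=> [x Vx|]; first exact: (derivableD (dF x Vx) (dG x Vx)).
apply: class_C_eq (IH _ _ (class_C_derive a FC) (class_C_derive a GC)) => //.
by move=> x; rewrite inE => Vx; exact/esym/(deriveD (dF x Vx) (dG x Vx)).
Qed.

Lemma class_C_mul m V F G : open V ->
  class_C m V F -> class_C m V G -> class_C m V (fun x => F x * G x).
Proof.
move=> Vo; elim: m F G => [|m IH] F G FC GC;
  (split=> [x Vx|]; first exact: (continuousM
    (class_C_continuous FC Vx) (class_C_continuous GC Vx))) => // a.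
have dF x (Vx : V x) := class_C_derivable (a:=a) FC Vx.
have dG x (Vx : V x) := class_C_derivable (a:=a) GC Vx.
split=> [x Vx|]; first exact: (derivableM (dF x Vx) (dG x Vx)).
have C1 := IH _ _ (class_C_le FC) (class_C_derive a GC).
have C2 := IH _ _ (class_C_le GC) (class_C_derive a FC).
apply: class_C_eq (class_C_add Vo C1 C2) => //.
by move=> x; rewrite inE => Vx; exact/esym/(deriveM (dF x Vx) (dG x Vx)).
Qed.

(** The derivative - F^-2 F' involves 1/F again, but only one order less of it, which is the
    induction hypothesis. *)
Lemma class_C_inv m V F : open V -> (forall x, V x -> F x != 0) ->
  class_C m V F -> class_C m V (fun x => (F x)^-1).
Proof.
move=> Vo F0; elim: m F F0 => [|m IH] F F0 FC;
  (split=> [x Vx|]; first exact: (continuousV (F0 x Vx)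
    (class_C_continuous FC Vx))) => // a.
have dF x (Vx : V x) := class_C_derivable (a:=a) FC Vx.
split=> [x Vx|]; first exact: (derivableV (F0 x Vx) (dF x Vx)).
have C1 := IH _ F0 (class_C_le FC).
have C2 := class_C_mul Vo (class_C_mul Vo C1 C1) (class_C_derive a FC).
apply: class_C_eq (class_C_mul Vo (class_C_cst m V (-1)) C2) => //.
move=> x; rewrite inE => Vx; rewrite (deriveV (F0 x Vx) (dF x Vx)).
by rewrite mulN1r -mulNr -invfM -expr2.
Qed.

(** The induction runs over all exponents at once, since differentiation lowers the exponent by
    one. *)
Lemma class_C_powR m V F (a : R) : open V -> (forall x, V x -> 0 < F x) ->
  class_C m V F -> class_C m V (fun x => F x `^ a).
Proof.
move=> Vo F0; elim: m F a F0 => [|m IH] F a F0 FC.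
  split=> // x Vx.
  apply: (@continuous_comp _ _ _ F (fun t => t `^ a)).
    exact: class_C_continuous FC Vx.
  apply: differentiable_continuous; apply/derivable1_diffP.
  by apply: derivable_powR; rewrite in_itv/= F0.
split=> [x Vx|b].
  apply: (@continuous_comp _ _ _ F (fun t => t `^ a)).
    exact: class_C_continuous FC Vx.
  apply: differentiable_continuous; apply/derivable1_diffP.
  by apply: derivable_powR; rewrite in_itv/= F0.
have D x (Vx : V x) := is_derive_powR a (F0 x Vx)
  (derivableP (class_C_derivable (a:=b) FC Vx)).
split=> [x Vx|]; first by have [] := D x Vx.
have C1 := IH _ (a - 1) F0 (class_C_le FC).
have C2 := class_C_mul Vo (class_C_mul Vo (class_C_cst m V a) C1)
  (class_C_derive b FC).
apply: class_C_eq C2 => //.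
by move=> x; rewrite inE => Vx; have [_ ->] := D x Vx.
Qed.

End ClassC.

(** * Symmetry of second partial derivatives *)

Section Schwarz.
Variables (R : realType) (n : nat).
Notation E := 'rV[R]_n.+1.
Implicit Types (V : set E) (F : E -> R) (x y v w : E).

Lemma is_derive_line F y v (s : R) : derivable F (y + s *: v) v ->
  is_derive s 1 (fun r : R => F (y + r *: v)) ('D_v F (y + s *: v)).
Proof.
move=> dF; have E0 : (fun h : R => h^-1 *: (((fun r => F (y + r *: v)) \o shift s) (h *: 1)
     - F (y + s *: v))) = (fun h => h^-1 *: ((F \o shift (y + s *: v)) (h *: v)
     - F (y + s *: v))).
  apply/funext => h /=; congr (_ *: (F _ - _)).
  by rewrite [_%:A]mulr1 scalerDl addrCA.
by split; rewrite /derivable /derive E0.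
Qed.

Lemma mean_value_line F y v (t : R) : 0 < t ->
  (forall s : R, 0 <= s <= t -> derivable F (y + s *: v) v) ->
  exists2 s, 0 <= s <= t & F (y + t *: v) - F y = t * 'D_v F (y + s *: v).
Proof.
move=> t0 dF; have D s : 0 <= s <= t -> is_derive s 1 (fun r : R => F (y + r *: v))
    ('D_v F (y + s *: v)) by move=> /dF; exact: is_derive_line.
have [s st|//|s sI] := @MVT R (fun r => F (y + r *: v))
    (fun s => 'D_v F (y + s *: v)) 0 t t0.
- by apply: D; move: st; rewrite in_itv /= => /andP[/ltW -> /ltW ->].
- apply: derivable_within_continuous => r; rewrite in_itv /= => /D.
  by case.
rewrite subr0 scale0r addr0 => ->; exists s; last by rewrite mulrC.
by move: sI; rewrite in_itv /= => /andP[/ltW -> /ltW ->].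
Qed.

(* The left-hand side is symmetric in v and w. *)
Lemma mean_value_rectangle F x v w (t : R) : 0 < t ->
  (forall a b : R, 0 <= a <= t -> 0 <= b <= t ->
     derivable F (x + a *: v + b *: w) v /\
     derivable ('D_v F) (x + a *: v + b *: w) w) ->
  exists a b : R, [/\ 0 <= a <= t, 0 <= b <= t &
    F (x + t *: v + t *: w) - F (x + t *: v) - F (x + t *: w) + F x
      = t * t * 'D_w ('D_v F) (x + a *: v + b *: w)].
Proof.
(* The second difference of F is the increment of G along v. The mean value theorem for G in the
   direction v, then for ['D_v F] in the direction w, gives the two parameters. *)
move=> t0 dF; pose G y := F (y + t *: w) - F y.
have tt : 0 <= t <= t by rewrite lexx ltW.
have t00 : 0 <= (0 : R) <= t by rewrite lexx ltW.
have dG a : 0 <= a <= t -> is_derive (x + a *: v) v G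
   ('D_v F (x + a *: v + t *: w) - 'D_v F (x + a *: v)).
  move=> at_; apply: is_deriveB; last first.
    by apply: derivableP; have := (dF a 0 at_ t00).1; rewrite scale0r addr0.
  have [+ _] := dF a t at_ tt; move: (x + a *: v) => z dz.
  have E0 : (fun h : R => h^-1 *: (((fun y => F (y + t *: w)) \o shift z) (h *: v)
     - F (z + t *: w))) = (fun h => h^-1 *: ((F \o shift (z + t *: w)) (h *: v)
     - F (z + t *: w))) by apply/funext => h /=; rewrite addrA.
  by split; rewrite /derivable /derive E0.
have [s st Gs] := mean_value_line t0 (fun s st => (@ex_derive _ _ _ _ _ _ _ (dG s st))).
have [b bt Gb] := mean_value_line t0
  (fun b bt => (dF s b st bt).2).
exists s, b; split => //; rewrite -mulrA -Gb -(derive_val (is_derive := dG s st)) -Gs.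
by rewrite /G [x + t *: v + _]addrC; ring.
Qed.

Lemma nbhs_rectangle x v w (A : set E) : nbhs x A ->
  exists2 t : R, 0 < t & forall a b : R, 0 <= a <= t -> 0 <= b <= t ->
    A (x + a *: v + b *: w).
Proof.
(* The summand 1 keeps N positive when both vectors vanish; halving e / N below makes the final
   inequality strict. *)
move=> /nbhs_ballP[e /= e0 eA]; pose N : R := `|v| + `|w| + 1.
have N0 : 0 < N by rewrite ltr_wpDl // addr_ge0.
exists (e / N / 2) => [|a b /andP[a0 at_] /andP[b0 bt]].
  by rewrite !divr_gt0.
apply: eA; rewrite -ball_normE /ball_ /= -addrA opprD addNKr normrN.
apply: le_lt_trans (ler_normD _ _) _; rewrite !normrZ !ger0_norm //.
apply: (@le_lt_trans _ _ (e / N / 2 * N)); last first.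
  by rewrite mulrAC mulfVK ?lt0r_neq0 // ltr_pdivrMr // ltr_pMr // ltr1n.
rewrite (@le_trans _ _ (e / N / 2 * (`|v| + `|w|))) //.
  by rewrite mulrDr lerD // ler_wpM2r.
by rewrite ler_wpM2l ?lerDl ?ler01 // ltW // !divr_gt0.
Qed.

(** The mean value theorem produces different intermediate points for the two orders of
    differentiation, so the values to compare are at distinct points y and z, both arbitrarily close
    to x. *)
Lemma continuous_eq_at (P Q : E -> R) x :
  {for x, continuous P} -> {for x, continuous Q} ->
  (forall A : set E, nbhs x A -> exists y z, [/\ A y, A z & P y = Q z]) ->
  P x = Q x.
Proof.
move=> cP cQ key; apply/eqP; rewrite -subr_eq0 -normr_le0.
apply/ler_addgt0Pr => e e0; rewrite add0r.
have e20 : 0 < e / 2 by rewrite divr_gt0.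
move/cvgr_dist_lt: cP => /(_ _ e20) nP; move/cvgr_dist_lt: cQ => /(_ _ e20) nQ.
have [y [z [[/= h1 _] [_ /= h2] PQ]]] := key _ (filterI nP nQ).
rewrite PQ in h1; rewrite (_ : P x - Q x = (P x - Q z) - (Q x - Q z)); last by ring.
by rewrite (le_trans (ler_normB _ _)) // [leRHS]splitr lerD // ltW.
Qed.

(** The second difference over a small rectangle at x, divided by t^2, is a value of either mixed
    derivative on that rectangle; continuity at x then identifies the two. *)
Lemma derive_swap (V : set E) F x v w : open V -> V x ->
  (forall y, V y -> derivable F y v /\ derivable F y w) ->
  (forall y, V y -> derivable ('D_v F) y w /\ derivable ('D_w F) y v) ->
  {for x, continuous ('D_w ('D_v F))} -> {for x, continuous ('D_v ('D_w F))} ->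
  'D_w ('D_v F) x = 'D_v ('D_w F) x.
Proof.
move=> Vo Vx d1 d2.
have key (A : set E) : nbhs x A ->
    exists y z, [/\ A y, A z & 'D_w ('D_v F) y = 'D_v ('D_w F) z].
  move=> nA; have [t t0 B] := nbhs_rectangle v w
    (filterI (open_nbhs_nbhs (conj Vo Vx)) nA).
  have [a [b [at_ bt E1]]] := mean_value_rectangle t0
    (fun a b ha hb => conj (d1 _ (B a b ha hb).1).1 (d2 _ (B a b ha hb).1).1).
  have swap y (r s : R) : y + r *: w + s *: v = y + s *: v + r *: w by rewrite addrAC.
  have [b' [a' [bt' at' E2]]] : exists a b : R, [/\ 0 <= a <= t, 0 <= b <= t &
      F (x + t *: w + t *: v) - F (x + t *: w) - F (x + t *: v) + F x
        = t * t * 'D_v ('D_w F) (x + a *: w + b *: v)].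
    apply: mean_value_rectangle t0 _ => r s hr hs; rewrite swap.
    by split; [exact: (d1 _ (B s r hs hr).1).2 | exact: (d2 _ (B s r hs hr).1).2].
  exists (x + a *: v + b *: w), (x + a' *: v + b' *: w).
  split; [exact: (B _ _ at_ bt).2|exact: (B _ _ at' bt').2|].
  have tt0 : t * t != 0 by rewrite mulf_neq0 // lt0r_neq0.
  apply: (mulfI tt0); apply: (etrans (esym E1)).
  by rewrite -(swap x b' a') -E2 (swap x t t); ring.
by move=> c1 c2; exact: (continuous_eq_at c1 c2 key).
Qed.

Lemma class_C_derive_swap (V : set E) F x a b : open V -> V x -> class_C 2 V F ->
  'D_(basis_vec R b) ('D_(basis_vec R a) F) x
  = 'D_(basis_vec R a) ('D_(basis_vec R b) F) x.
Proof.
move=> Vo Vx FC; apply: (derive_swap Vo Vx).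
- by move=> y Vy; split; exact: class_C_derivable (class_C_le FC) Vy.
- by move=> y Vy; split; exact: class_C_derivable (class_C_derive _ FC) Vy.
- exact: class_C_continuous (class_C_derive _ (class_C_derive _ FC)) Vx.
- exact: class_C_continuous (class_C_derive _ (class_C_derive _ FC)) Vx.
Qed.

End Schwarz.

(** * Partial derivatives in the interior of a chart *)

Section InteriorOfChart.
Variables (R : realType) (n : nat) (T : topologicalType) (u : chart R n T).
Notation E := 'rV[R]_n.+1.
Implicit Types (f g : T -> R) (p q : T) (a b : 'I_n.+1).

(** The image of a chart is open only relative to the half-space; this part of it is open in the
    whole space. *)
Definition interior_image : set E := chart_image u `&` [set x | 0 < x 0 ord0].

Definition interior_dom : set T :=
  [set p | chart_dom u p /\ 0 < chart_coord u p 0 ord0].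

Definition smooth_interior f : Prop :=
  forall m, class_C m interior_image (f \o chart_param u).

Lemma open_interior_image : open interior_image.
Proof.
have [W Wo eW] := chart_image_open u.
have -> : interior_image = W `&` [set x : E | 0 < x 0 ord0].
  apply/seteqP; split => x [xW x0].
    by split => //; move: xW; rewrite /chart_image eW => -[].
  by split => //; rewrite /chart_image eW; split => //; exact: ltW.
apply: openI => //; have := @open_gt R 0.
by apply: open_comp => x _; exact: coord_continuous.
Qed.

Lemma interior_image_coord p : interior_dom p -> interior_image (chart_coord u p).
Proof. by move=> [Dp p0]; split => //; exists p. Qed.

Lemma interior_image_param x : interior_image x ->
  interior_dom (chart_param u x) /\ chart_coord u (chart_param u x) = x.
Proof.
by move=> [[q Dq <-] x0]; rewrite chart_coordK.
Qed.

(** The chart image contains a full neighbourhood of the point, so restricting the punctured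
    neighbourhoods of 0 to steps that stay in the image does not change the filter. *)
Lemma pd_derive a f p : interior_dom p ->
  pd u a f p = 'D_(basis_vec R a) (f \o chart_param u) (chart_coord u p).
Proof.
move=> Hp; have [Dp _] := Hp; set x := chart_coord u p.
have nx : \forall h \near 0^', chart_image u (x + h *: basis_vec R a).
  have cx : (x + h *: basis_vec R a) @[h --> (0:R)] --> x.
    suff : (x + h *: basis_vec R a) @[h --> (0:R)] --> x + 0 *: basis_vec R a.
      by rewrite scale0r addr0.
    by apply: cvgD; [exact: cvg_cst|apply: cvgZr_tmp; exact: cvg_id].
  apply: cvg_within; near=> h.
  have : interior_image (x + h *: basis_vec R a).
    near: h; apply: cx; apply: open_nbhs_nbhs; split.
      exact: open_interior_image.
    exact: interior_image_coord.
  by case.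
rewrite /pd /derive; set F1 := fun h : R => _; set F2 := fun h : R => h^-1 *: _.
have -> : F1 = F2.
  apply/funext => h; rewrite /F1 /F2 /= /x chart_coordK // [_ + h *: _]addrC //.
congr (lim _); apply/seteqP; split => A; rewrite /within /=.
  by move=> h; apply: filterS2 nx h => y Sy; exact.
by apply: filterS.
Unshelve. all: by end_near. Qed.

Lemma param_coord_near p : interior_dom p ->
  \forall x \near chart_coord u p, interior_image x.
Proof.
move=> Hp; apply: open_nbhs_nbhs; split; first exact: open_interior_image.
exact: interior_image_coord.
Qed.

Lemma eq_pd a f g p : (forall q, interior_dom q -> f q = g q) ->
  interior_dom p -> pd u a f p = pd u a g p.
Proof.
move=> fg Hp; rewrite !pd_derive //; apply: near_eq_derive.
by apply: filterS (param_coord_near Hp) => x /interior_image_param[/fg].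
Qed.

Lemma eq_smooth f g : (forall q, interior_dom q -> f q = g q) ->
  smooth_interior f -> smooth_interior g.
Proof.
move=> fg fC m; apply: class_C_eq (fC m); first exact: open_interior_image.
by move=> x; rewrite inE => /interior_image_param[/fg].
Qed.

(** The local extensions in [smooth_at] vary with the point, but on the open interior image each of
    them coincides with f read in the chart. *)
Lemma smooth_at_interior f : (forall p, interior_dom p -> smooth_at u f p) ->
  smooth_interior f.
Proof.
move=> fp m; apply: class_C_local => x Dx.
have [Hp xE] := interior_image_param Dx.
have [V [F [Vo Vx FC Ff]]] := fp _ Hp; rewrite xE in Vx.
exists (V `&` interior_image); first exact: openI Vo open_interior_image.
split => //; apply: class_C_eq (class_C_sub _ (FC m)).
- exact: openI Vo open_interior_image.
- by move=> y; rewrite inE => -[Vy [Iy _]]; exact: Ff.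
- by move=> y [].
Qed.

Lemma smooth_interior_at f p : interior_dom p -> smooth_interior f ->
  smooth_at u f p.
Proof.
move=> Hp fC; exists interior_image, (f \o chart_param u); split => //.
- exact: open_interior_image.
- exact: interior_image_coord.
Qed.

Lemma smooth_cst (r : R) : smooth_interior (fun=> r).
Proof. by move=> m; exact: class_C_cst. Qed.

Lemma smoothD f g : smooth_interior f -> smooth_interior g ->
  smooth_interior (fun q => f q + g q).
Proof. by move=> fC gC m; apply: class_C_add (fC m) (gC m); exact: open_interior_image. Qed.

Lemma smoothM f g : smooth_interior f -> smooth_interior g ->
  smooth_interior (fun q => f q * g q).
Proof. by move=> fC gC m; apply: class_C_mul (fC m) (gC m); exact: open_interior_image. Qed.

Lemma smoothN f : smooth_interior f -> smooth_interior (fun q => - f q).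
Proof.
move=> fC; have := smoothM (smooth_cst (-1)) fC.
by apply: eq_smooth => q _; rewrite mulN1r.
Qed.

Lemma smoothB f g : smooth_interior f -> smooth_interior g ->
  smooth_interior (fun q => f q - g q).
Proof. by move=> fC gC; exact: smoothD fC (smoothN gC). Qed.

Lemma smooth_sum (I : finType) (P : pred I) (F : I -> T -> R) :
  (forall i, smooth_interior (F i)) -> smooth_interior (fun q => \sum_(i | P i) F i q).
Proof.
move=> FC.
have -> : (fun q => \sum_(i | P i) F i q) = \sum_(i | P i) F i.
  by apply/funext => q; rewrite fct_sumE.
elim/big_ind: _ => [|f g fC gC|i _]; [exact: smooth_cst|exact: smoothD|exact: FC].
Qed.

Lemma smooth_prod (I : finType) (F : I -> T -> R) :
  (forall i, smooth_interior (F i)) -> smooth_interior (fun q => \prod_i F i q).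
Proof.
move=> FC.
have -> : (fun q => \prod_i F i q) = \prod_i F i.
  by apply/funext => q; elim/big_rec2: _ => // i x y _ ->.
elim/big_ind: _ => [|f g fC gC|i _]; [exact: smooth_cst|exact: smoothM|exact: FC].
Qed.

Lemma smoothV f : (forall q, interior_dom q -> f q != 0) -> smooth_interior f ->
  smooth_interior (fun q => (f q)^-1).
Proof.
move=> f0 fC m; apply: class_C_inv (fC m); first exact: open_interior_image.
by move=> x /interior_image_param[/f0].
Qed.

Lemma smooth_powR f (r : R) : (forall q, interior_dom q -> 0 < f q) ->
  smooth_interior f -> smooth_interior (fun q => f q `^ r).
Proof.
move=> f0 fC m; apply: (class_C_powR (F := f \o chart_param u)) (fC m).
  exact: open_interior_image.
by move=> x /interior_image_param[/f0].
Qed.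

Lemma smooth_pd a f : smooth_interior f -> smooth_interior (pd u a f).
Proof.
move=> fC m; apply: class_C_eq (class_C_derive a (fC m.+1)).
  exact: open_interior_image.
move=> x; rewrite inE => /interior_image_param[Hp xE] /=.
by rewrite pd_derive // xE.
Qed.

Lemma derivable_smooth a f p : smooth_interior f -> interior_dom p ->
  derivable (f \o chart_param u) (chart_coord u p) (basis_vec R a).
Proof.
by move=> fC /interior_image_coord Hp; exact: class_C_derivable (fC 1) Hp.
Qed.

Lemma pd_cst a (r : R) p : interior_dom p -> pd u a (fun=> r) p = 0.
Proof. by move=> Hp; rewrite pd_derive //; exact: derive_cst. Qed.

Lemma pdD a f g p : smooth_interior f -> smooth_interior g -> interior_dom p ->
  pd u a (fun q => f q + g q) p = pd u a f p + pd u a g p.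
Proof.
move=> fC gC Hp; rewrite !pd_derive //.
exact: (deriveD (derivable_smooth fC Hp) (derivable_smooth gC Hp)).
Qed.

Lemma pdM a f g p : smooth_interior f -> smooth_interior g -> interior_dom p ->
  pd u a (fun q => f q * g q) p = f p * pd u a g p + pd u a f p * g p.
Proof.
move=> fC gC Hp; rewrite !pd_derive //.
rewrite [LHS](deriveM (derivable_smooth fC Hp) (derivable_smooth gC Hp)).
have [Dp _] := Hp; rewrite /= chart_coordK //; congr (_ + _); exact: mulrC.
Qed.

Lemma pdN a f p : smooth_interior f -> interior_dom p ->
  pd u a (fun q => - f q) p = - pd u a f p.
Proof.
move=> fC Hp; rewrite !pd_derive //; exact: (deriveN (derivable_smooth fC Hp)).
Qed.

Lemma pdB a f g p : smooth_interior f -> smooth_interior g -> interior_dom p ->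
  pd u a (fun q => f q - g q) p = pd u a f p - pd u a g p.
Proof. by move=> fC gC Hp; rewrite (pdD _ fC (smoothN gC)) // pdN. Qed.

Lemma pdZ a (r : R) f p : smooth_interior f -> interior_dom p ->
  pd u a (fun q => r * f q) p = r * pd u a f p.
Proof.
by move=> fC Hp; rewrite (pdM _ (smooth_cst r) fC) // pd_cst // mul0r addr0.
Qed.

Lemma pd_sum (I : finType) (P : pred I) (F : I -> T -> R) a p :
  (forall i, smooth_interior (F i)) -> interior_dom p ->
  pd u a (fun q => \sum_(i | P i) F i q) p = \sum_(i | P i) pd u a (F i) p.
Proof.
move=> FC Hp.
have -> : (fun q => \sum_(i | P i) F i q) = \sum_(i | P i) F i.
  by apply/funext => q; rewrite fct_sumE.
suff [] : smooth_interior (\sum_(i | P i) F i) /\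
  pd u a (\sum_(i | P i) F i) p = \sum_(i | P i) pd u a (F i) p by [].
elim/big_rec2: _ => [|i y f _ [fC fE]].
  by split; [exact: smooth_cst|exact: pd_cst].
by split; [exact: smoothD|rewrite -fE -pdD].
Qed.

Lemma pd_powR a (r : R) f p : (forall q, interior_dom q -> 0 < f q) ->
  smooth_interior f -> interior_dom p ->
  pd u a (fun q => f q `^ r) p = r * f p `^ (r - 1) * pd u a f p.
Proof.
move=> f0 fC Hp; rewrite !pd_derive //; have [Dp _] := Hp.
have fp : 0 < (f \o chart_param u) (chart_coord u p) by rewrite /= chart_coordK //; exact: f0.
have := is_derive_powR r fp (derivableP (derivable_smooth (a := a) fC Hp)).
by rewrite /= chart_coordK // => -[_ <-].
Qed.

Lemma pdV a f p : (forall q, interior_dom q -> f q != 0) -> smooth_interior f ->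
  interior_dom p -> pd u a (fun q => (f q)^-1) p = - (f p)^-1 ^+ 2 * pd u a f p.
Proof.
move=> f0 fC Hp; have fV := smoothV f0 fC.
have : pd u a (fun q => f q * (f q)^-1) p = 0.
  rewrite (@eq_pd a _ (fun=> 1)) ?pd_cst // => q Hq.
  by rewrite mulfV // f0.
rewrite pdM // => H; have fp := f0 p Hp.
apply: (mulfI fp); move: H => /eqP; rewrite addr_eq0 => /eqP ->.
by field.
Qed.

Lemma pd_swap a b f p : smooth_interior f -> interior_dom p ->
  pd u a (pd u b f) p = pd u b (pd u a f) p.
Proof.
move=> fC Hp.
have D c d : pd u c (pd u d f) p =
    'D_(basis_vec R c) ('D_(basis_vec R d) (f \o chart_param u)) (chart_coord u p).
  rewrite (pd_derive c (pd u d f) Hp); apply: near_eq_derive.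
  apply: filterS (param_coord_near Hp) => x /interior_image_param[Hq xE] /=.
  by rewrite (pd_derive d f Hq) xE.
rewrite !D; apply: class_C_derive_swap (fC 2).
  exact: open_interior_image.
exact: interior_image_coord.
Qed.

End InteriorOfChart.

(** * Exterior and interior multiplication *)

Section ExteriorAlgebra.
Variables (R : realType) (n : nat).
Notation X := (ext_form R n).
Implicit Types (a b : 'I_n.+1) (S : {set 'I_n.+1}) (w : X) (r : R).

Lemma emul_basis_is_linear a : linear (emul_basis a : X -> X).
Proof.
move=> r w1 w2; apply/ffunP => S; rewrite !ffunE.
by case: ifP => _; rewrite ?scaler0 ?addr0 // mulrDr [LHS]addrC addrC /GRing.scale /= mulrCA.
Qed.

Lemma imul_basis_is_linear a : linear (imul_basis a : X -> X).
Proof.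
move=> r w1 w2; apply/ffunP => S; rewrite !ffunE.
by case: ifP => _; rewrite ?scaler0 ?addr0 // mulrDr /GRing.scale /= mulrCA.
Qed.

HB.instance Definition _ a := GRing.isLinear.Build R X X _ (emul_basis a)
  (emul_basis_is_linear a).
HB.instance Definition _ a := GRing.isLinear.Build R X X _ (imul_basis a)
  (imul_basis_is_linear a).

Lemma koszul_signK a S : koszul_sign R a S * koszul_sign R a S = 1.
Proof. by rewrite /koszul_sign -expr2 sqrr_sign. Qed.

Lemma koszul_signU1 a c S : c \notin S ->
  koszul_sign R a (c |: S)%SET = (-1) ^+ (c < a)%N * koszul_sign R a S.
Proof.
move=> cS; rewrite /koszul_sign -exprD; congr (_ ^+ _).
have -> : [set b in c |: S | (b < a)%N]%SET =
   ((if (c < a)%N then [set c] else finset.set0) :|: [set b in S | (b < a)%N])%SET.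
  apply/finset.setP => b; rewrite !inE; case: ifP => ca; rewrite !inE;
  by case: eqVneq => //= ->; rewrite ca ?andbF.
rewrite cardsU; case: ifP => ca; last by rewrite cards0 finset.set0I cards0 subn0.
rewrite cards1 (_ : (_ :&: _)%SET = finset.set0) ?cards0 ?subn0 //.
by apply/finset.setP => b; rewrite !inE; case: eqVneq => //= ->; rewrite (negbTE cS).
Qed.

(** Of two distinct indices exactly one lies below the other, so exactly one of the two insertions
    contributes an extra sign. *)
Lemma koszul_swap a b S : a != b -> a \notin S -> b \notin S ->
  koszul_sign R a (b |: S)%SET * koszul_sign R b S
  = - (koszul_sign R b (a |: S)%SET * koszul_sign R a S).
Proof.
move=> ab aS bS; rewrite !koszul_signU1 //.
have : a != b :> nat by [].
by case: ltngtP => // _ _; rewrite !expr0 !expr1; ring.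
Qed.

Lemma imul_basis_anticomm a b w :
  imul_basis a (imul_basis b w) = - imul_basis b (imul_basis a w).
Proof.
apply/ffunP => S; rewrite !ffunE !inE.
have [<-|ab] := eqVneq a b; first by case: ifP; rewrite /= ?mulr0 oppr0.
rewrite /=.
have [aS|aS] := boolP (a \in S); have [bS|bS] := boolP (b \in S);
  rewrite ?mulr0 ?oppr0 //.
rewrite finset.setUCA !mulrA -mulNr; congr (_ * _).
by rewrite mulrC [in RHS]mulrC koszul_swap // eq_sym.
Qed.

Lemma emul_imul_basis a b w :
  emul_basis a (imul_basis b w) + imul_basis b (emul_basis a w)
  = (a == b)%:R *: w.
Proof.
apply/ffunP => S; rewrite !ffunE !inE.
have [<-|ab] := eqVneq a b.
  rewrite /= scale1r; have [aS|aS] := boolP (a \in S).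
    by rewrite addr0 mulrA koszul_signK mul1r finset.setD1K.
  by rewrite add0r finset.setU1K // mulrA koszul_signK mul1r.
rewrite /= scale0r.
have [bS|bS] := boolP (b \in S).
  by rewrite mulr0 addr0; case: ifP.
have [aS|aS] := boolP (a \in S); last by rewrite add0r mulr0.
have -> : ((b |: S) :\ a = b |: (S :\ a))%SET.
  by apply/finset.setP => c; rewrite !inE; case: (eqVneq c a) => [->|]; rewrite ?(negbTE ab).
have kb : koszul_sign R b S = (-1) ^+ (a < b)%N * koszul_sign R b (S :\ a)%SET.
  by rewrite -{1}(finset.setD1K aS) koszul_signU1 // !inE eqxx.
have nab : a != b :> nat by [].
rewrite kb koszul_signU1 ?inE ?(negbTE bS) ?andbF //.
by move: nab; case: ltngtP => // _ _; rewrite !expr0 !expr1; ring.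
Qed.

Lemma imul_emul_basis a b w :
  imul_basis b (emul_basis a w) = (a == b)%:R *: w - emul_basis a (imul_basis b w).
Proof. by rewrite -emul_imul_basis [X in X - _]addrC addrK. Qed.

(** Each summand is the projection onto the components whose index set contains a. *)
Lemma degree_basis w S : (\sum_a emul_basis a (imul_basis a w)) S = #|S|%:R * w S.
Proof.
rewrite sum_ffunE.
rewrite (eq_bigr (fun a => (a \in S)%:R * w S)); last first.
  move=> a _; rewrite !ffunE !inE eqxx /=; case: ifP => aS; last by rewrite mul0r.
  by rewrite mulrA koszul_signK mul1r mul1r finset.setD1K.
rewrite -mulr_suml -natr_sum; congr (_%:R * _).
by rewrite -sum1_card [RHS]big_mkcond; apply: eq_bigr => a _; case: (a \in S).
Qed.

(* Here v is a vector, whereas [imul] takes a covector and a metric. *)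
Definition interior_mul (v : 'rV[R]_n.+1) w : X := \sum_b v 0 b *: imul_basis b w.

(** The common shape of [derivation_action], of the connection term in [nabla] and of the Hessian
    action; they differ only in the matrix. *)
Definition derivation (M : 'M[R]_n.+1) w : X :=
  \sum_a \sum_b M a b *: emul_basis a (imul_basis b w).

Implicit Types (v : 'rV[R]_n.+1) (M G P : 'M[R]_n.+1).

Lemma imulE G v w : (G^T = G) -> imul G v w = interior_mul (v *m invmx G) w.
Proof.
move=> Gs; rewrite /imul /interior_mul exchange_big; apply: eq_bigr => b _.
by rewrite mxE scaler_suml; apply: eq_bigr => a _; rewrite mulrC.
Qed.

Lemma derivation_actionE G P w : derivation_action G P w = derivation (P *m invmx G) w.
Proof. by []. Qed.

Lemma emul_is_linear v : linear (emul v : X -> X).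
Proof.
move=> r w1 w2; rewrite /emul scaler_sumr -big_split; apply: eq_bigr => a _ /=.
by rewrite linearP scalerDr !scalerA [r * _]mulrC.
Qed.

Lemma interior_mul_is_linear v : linear (interior_mul v).
Proof.
move=> r w1 w2; rewrite /interior_mul scaler_sumr -big_split; apply: eq_bigr => a _ /=.
by rewrite linearP scalerDr !scalerA [r * _]mulrC.
Qed.

Lemma derivation_is_linear M : linear (derivation M).
Proof.
move=> r w1 w2; rewrite /derivation scaler_sumr -big_split; apply: eq_bigr => a _ /=.
rewrite scaler_sumr -big_split; apply: eq_bigr => b _ /=.
by rewrite (linearP (imul_basis b)) (linearP (emul_basis a)) scalerDr !scalerA [r * _]mulrC.
Qed.

HB.instance Definition _ v := GRing.isLinear.Build R X X _ (emul v) (emul_is_linear v).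
HB.instance Definition _ v := GRing.isLinear.Build R X X _ (interior_mul v)
  (interior_mul_is_linear v).
HB.instance Definition _ M := GRing.isLinear.Build R X X _ (derivation M)
  (derivation_is_linear M).

Lemma imul_is_linear G v : linear (imul G v : X -> X).
Proof.
move=> r w1 w2; rewrite /imul scaler_sumr -big_split; apply: eq_bigr => a _ /=.
rewrite scaler_sumr -big_split; apply: eq_bigr => b _ /=.
by rewrite linearP scalerDr !scalerA [r * _]mulrC.
Qed.

HB.instance Definition _ G v := GRing.isLinear.Build R X X _ (imul G v)
  (imul_is_linear G v).

Lemma emulD v1 v2 w : emul (v1 + v2) w = emul v1 w + emul v2 w.
Proof. by rewrite /emul -big_split; apply: eq_bigr => a _; rewrite mxE scalerDl. Qed.

Lemma emulZ r v w : emul (r *: v) w = r *: emul v w.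
Proof. by rewrite /emul scaler_sumr; apply: eq_bigr => a _; rewrite mxE scalerA. Qed.

Lemma emulB v1 v2 w : emul (v1 - v2) w = emul v1 w - emul v2 w.
Proof. by rewrite emulD -scaleN1r emulZ scaleN1r. Qed.

Lemma interior_mulDl v1 v2 w : interior_mul (v1 + v2) w = interior_mul v1 w + interior_mul v2 w.
Proof. by rewrite /interior_mul -big_split; apply: eq_bigr => a _; rewrite mxE scalerDl. Qed.

Lemma interior_mulZl r v w : interior_mul (r *: v) w = r *: interior_mul v w.
Proof. by rewrite /interior_mul scaler_sumr; apply: eq_bigr => a _; rewrite mxE scalerA. Qed.

Lemma derivationD M1 M2 w : derivation (M1 + M2) w = derivation M1 w + derivation M2 w.
Proof.
rewrite /derivation -big_split; apply: eq_bigr => a _; rewrite -big_split.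
by apply: eq_bigr => b _; rewrite mxE scalerDl.
Qed.

Lemma derivationZ r M w : derivation (r *: M) w = r *: derivation M w.
Proof.
rewrite /derivation scaler_sumr; apply: eq_bigr => a _; rewrite scaler_sumr.
by apply: eq_bigr => b _; rewrite mxE scalerA.
Qed.

Lemma derivation_tensor (v1 v2 : 'rV[R]_n.+1) w :
  derivation (v1^T *m v2) w = emul v1 (interior_mul v2 w).
Proof.
rewrite /derivation /emul /interior_mul; apply: eq_bigr => a _.
rewrite linear_sum scaler_sumr; apply: eq_bigr => b _.
by rewrite linearZ scalerA mxE big_ord1 mxE.
Qed.

Lemma derivation1 (k : nat) w : (forall S, #|S| != k -> w S = 0) ->
  derivation 1%:M w = k%:R *: w.
Proof.
move=> wk; apply/ffunP => S; rewrite /derivation.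
have -> : \sum_a \sum_b (1%:M : 'M[R]_n.+1) a b *: emul_basis a (imul_basis b w)
   = \sum_a emul_basis a (imul_basis a w).
  apply: eq_bigr => a _; rewrite (bigD1 a) //= mxE eqxx scale1r.
  by rewrite big1 ?addr0 // => b ba; rewrite mxE eq_sym (negbTE ba) scale0r.
rewrite degree_basis !ffunE; have [->//|/wk ->] := eqVneq #|S| k.
by rewrite scaler0 mulr0.
Qed.

Lemma interior_mul_emul (v1 v2 : 'rV[R]_n.+1) w :
  interior_mul v2 (emul v1 w) = (v1 *m v2^T) 0 0 *: w - emul v1 (interior_mul v2 w).
Proof.
rewrite -derivation_tensor /derivation /interior_mul /emul.
under eq_bigr do rewrite linear_sum scaler_sumr.
rewrite exchange_big /= mxE scaler_suml -sumrB; apply: eq_bigr => a _.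
under eq_bigr => b _ do rewrite linearZ /= imul_emul_basis !scalerBr !scalerA.
rewrite sumrB; congr (_ - _).
  rewrite (bigD1 a) //= eqxx mulr1 big1 ?addr0 ?mxE // 1?mulrC //.
  by move=> b ba; rewrite eq_sym (negbTE ba) mulr0 scale0r.
by apply: eq_bigr => b _; rewrite mxE big_ord1 mxE mulrC.
Qed.

Lemma interior_mulK v w : interior_mul v (interior_mul v w) = 0.
Proof.
have H : interior_mul v (interior_mul v w) = - interior_mul v (interior_mul v w).
  rewrite {1}/interior_mul /interior_mul.
  under eq_bigr do rewrite linear_sum scaler_sumr.
  rewrite [in LHS]exchange_big /= -sumrN; apply: eq_bigr => a _; rewrite -sumrN; apply: eq_bigr => b _.
  by rewrite !linearZ /= imul_basis_anticomm !scalerN !scalerA mulrC.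
have : 2%:R *: interior_mul v (interior_mul v w) = 0.
  by rewrite scaler_nat mulr2n {1}H addNr.
by move/eqP; rewrite scaler_eq0 pnatr_eq0 /= => /eqP.
Qed.

Lemma emul_basis_anticomm a b w :
  emul_basis a (emul_basis b w) = - emul_basis b (emul_basis a w).
Proof.
apply/ffunP => S; rewrite !ffunE !inE.
have [<-|ab] := eqVneq a b; first by case: ifP; rewrite /= ?mulr0 oppr0.
rewrite /=; have [aS|aS] := boolP (a \in S); have [bS|bS] := boolP (b \in S);
  rewrite ?mulr0 ?oppr0 //.
have -> : ((S :\ b) :\ a = (S :\ a) :\ b)%SET.
  by apply/finset.setP => c; rewrite !inE andbCA.
set S0 := ((S :\ a) :\ b)%SET.
have ea : (S :\ a = b |: S0)%SET by rewrite finset.setD1K // !inE bS eq_sym ab.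
have eb : (S :\ b = a |: S0)%SET.
  by apply/finset.setP => c; rewrite !inE; case: (eqVneq c a) => [->|]; rewrite ?ab.
have aS0 : a \notin S0 by rewrite !inE eqxx andbF.
have bS0 : b \notin S0 by rewrite !inE eqxx.
rewrite ea eb !mulrA -mulNr; congr (_ * _).
by rewrite koszul_swap.
Qed.

Lemma emul_anticomm_basis a v w : emul_basis a (emul v w) = - emul v (emul_basis a w).
Proof.
rewrite /emul linear_sum -sumrN; apply: eq_bigr => b _.
by rewrite linearZ /= emul_basis_anticomm scalerN.
Qed.

Lemma interior_mul_anticomm_basis a v w :
  imul_basis a (interior_mul v w) = - interior_mul v (imul_basis a w).
Proof.
rewrite /interior_mul linear_sum -sumrN; apply: eq_bigr => b _.
by rewrite linearZ /= imul_basis_anticomm scalerN.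
Qed.

Lemma imul_basis_emul a v w :
  imul_basis a (emul v w) = v 0 a *: w - emul v (imul_basis a w).
Proof.
rewrite /emul linear_sum (eq_bigr (fun b => (v 0 b * (b == a)%:R) *: w
    - v 0 b *: emul_basis b (imul_basis a w))); last first.
  by move=> b _; rewrite linearZ /= imul_emul_basis scalerBr scalerA.
rewrite sumrB; congr (_ - _); rewrite (bigD1 a) //= eqxx mulr1 big1 ?addr0 //.
by move=> b /negbTE ->; rewrite mulr0 scale0r.
Qed.

Lemma interior_mul_emul_basis a v w :
  interior_mul v (emul_basis a w) = v 0 a *: w - emul_basis a (interior_mul v w).
Proof.
rewrite /interior_mul linear_sum (eq_bigr (fun b => (v 0 b * (a == b)%:R) *: w
    - emul_basis a (v 0 b *: imul_basis b w))); last first.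
  by move=> b _; rewrite linearZ /= imul_emul_basis scalerBr scalerA.
rewrite sumrB; congr (_ - _); rewrite (bigD1 a) //= eqxx mulr1 big1 ?addr0 //.
by move=> b; rewrite eq_sym => /negbTE ->; rewrite mulr0 scale0r.
Qed.

Lemma derivation_emul M v w :
  derivation M (emul v w) = emul v (derivation M w) + emul (v *m M^T) w.
Proof.
rewrite /derivation {3}/emul linear_sum -big_split; apply: eq_bigr => a _ /=.
rewrite linear_sum mxE scaler_suml -big_split; apply: eq_bigr => b _ /=.
rewrite imul_basis_emul linearB /= linearZ /= emul_anticomm_basis opprK.
by rewrite scalerDr scalerA mxE [in RHS]linearZ addrC mulrC.
Qed.

(** The minus sign and the missing transpose, compared with [derivation_emul], reflect the dual
    action of M on vectors. *)
Lemma derivation_interior_mul M v w :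
  derivation M (interior_mul v w) = interior_mul v (derivation M w) - interior_mul (v *m M) w.
Proof.
have -> : interior_mul (v *m M) w = \sum_b \sum_a (v 0 a * M a b) *: imul_basis b w.
  by apply: eq_bigr => b _; rewrite mxE scaler_suml.
rewrite /derivation [X in _ - X]exchange_big linear_sum -sumrB; apply: eq_bigr => a _ /=.
rewrite linear_sum -sumrB; apply: eq_bigr => b _ /=.
rewrite interior_mul_anticomm_basis linearN /= linearZ /= interior_mul_emul_basis.
by rewrite scalerBr scalerA [M a b * _]mulrC addrAC subrr add0r scalerN.
Qed.

End ExteriorAlgebra.

(** * Calculus of matrix-valued functions in a chart *)

Section MatrixFields.
Variables (R : realType) (n : nat) (T : topologicalType) (u : chart R n T).
Implicit Types (a : 'I_n.+1) (p q : T).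

Definition smooth_mx m k (M : T -> 'M[R]_(m, k)) : Prop :=
  forall i j, smooth_interior u (fun q => M q i j).

Definition pd_mx m k a (M : T -> 'M[R]_(m, k)) p : 'M[R]_(m, k) :=
  \matrix_(i, j) pd u a (fun q => M q i j) p.

Lemma eq_pd_mx m k a (M N : T -> 'M[R]_(m, k)) p :
  (forall q, interior_dom u q -> M q = N q) -> interior_dom u p ->
  pd_mx a M p = pd_mx a N p.
Proof.
move=> MN Hp; apply/matrixP => i j; rewrite !mxE.
by apply: eq_pd => // q Hq; rewrite MN.
Qed.

Lemma smooth_mxM m k l (M : T -> 'M[R]_(m, k)) (N : T -> 'M[R]_(k, l)) :
  smooth_mx M -> smooth_mx N -> smooth_mx (fun q => M q *m N q).
Proof.
move=> MC NC i j; apply: (@eq_smooth _ _ _ _ (fun q => \sum_h M q i h * N q h j)).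
  by move=> q _; rewrite mxE.
by apply: smooth_sum => h; exact: smoothM.
Qed.

Lemma pd_mxM m k l a (M : T -> 'M[R]_(m, k)) (N : T -> 'M[R]_(k, l)) p :
  smooth_mx M -> smooth_mx N -> interior_dom u p ->
  pd_mx a (fun q => M q *m N q) p = pd_mx a M p *m N p + M p *m pd_mx a N p.
Proof.
move=> MC NC Hp; apply/matrixP => i j; rewrite !mxE.
rewrite (@eq_pd _ _ _ _ _ _ (fun q => \sum_h M q i h * N q h j)) //; last first.
  by move=> q _; rewrite mxE.
rewrite pd_sum //; last by move=> h; exact: smoothM.
rewrite -big_split; apply: eq_bigr => h _ /=; rewrite !mxE pdM //.
by rewrite addrC.
Qed.

Lemma smooth_det k (M : T -> 'M[R]_k) : smooth_mx M ->
  smooth_interior u (fun q => \det (M q)).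
Proof.
move=> MC; apply: smooth_sum => s; apply: smoothM; first exact: smooth_cst.
by apply: smooth_prod => i.
Qed.

(** By Cramer's rule the entries are cofactors divided by the determinant. *)
Lemma smooth_invmx k (M : T -> 'M[R]_k) :
  (forall q, interior_dom u q -> M q \in unitmx) ->
  smooth_mx M -> smooth_mx (fun q => invmx (M q)).
Proof.
move=> Mu MC i j.
apply: (@eq_smooth _ _ _ _ (fun q => (\det (M q))^-1 * cofactor (M q) j i)).
  by move=> q Hq; rewrite /invmx Mu // !mxE.
apply: smoothM; first apply: smoothV; last 2 first.
- exact: smooth_det.
- apply: smoothM; first exact: smooth_cst.
  apply: smooth_det => a b; apply: eq_smooth (MC (lift j a) (lift i b)) => q _.
  by rewrite !mxE.
- by move=> q /Mu; rewrite unitmxE unitfE.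
Qed.

Lemma pd_mx_inv k a (M : T -> 'M[R]_k) p :
  (forall q, interior_dom u q -> M q \in unitmx) -> smooth_mx M -> interior_dom u p ->
  pd_mx a (fun q => invmx (M q)) p = - (invmx (M p) *m pd_mx a M p *m invmx (M p)).
Proof.
move=> Mu MC Hp; have IC := smooth_invmx Mu MC.
have : pd_mx a (fun q => M q *m invmx (M q)) p = 0.
  rewrite (@eq_pd_mx _ _ _ _ (fun=> 1%:M)) //; last by move=> q Hq; rewrite mulmxV ?Mu.
  by apply/matrixP => i j; rewrite !mxE pd_cst.
rewrite pd_mxM // => /(congr1 (mulmx (invmx (M p)))).
rewrite mulmx0 mulmxDr !mulmxA mulVmx ?Mu // mul1mx => /eqP.
by rewrite addrC addr_eq0 => /eqP.
Qed.

End MatrixFields.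

(** * Differential forms and the Levi-Civita connection *)

Section FormCalculus.
Variables (R : realType) (n : nat) (T : topologicalType) (u : chart R n T).
Notation X := (ext_form R n).
Notation inner := (interior_dom u).
Implicit Types (a b : 'I_n.+1) (p q : T) (w : T -> X) (f : T -> R).

Definition smooth_form w : Prop := forall S, smooth_interior u (fun q => w q S).

Definition pd_form a w p : X := [ffun S => pd u a (fun q => w q S) p].

Lemma eq_pd_form a w1 w2 p : (forall q, inner q -> w1 q = w2 q) -> inner p ->
  pd_form a w1 p = pd_form a w2 p.
Proof.
move=> ew Hp; apply/ffunP => S; rewrite !ffunE; apply: eq_pd => // q Hq.
by rewrite ew.
Qed.

Lemma eq_smooth_form w1 w2 : (forall q, inner q -> w1 q = w2 q) ->
  smooth_form w1 -> smooth_form w2.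
Proof. by move=> ew wC S; apply: eq_smooth (wC S) => q Hq; rewrite ew. Qed.

Lemma smooth_form0 : smooth_form (fun=> 0).
Proof.
move=> S; apply: eq_smooth (smooth_cst u 0) => q _.
by rewrite ffunE.
Qed.

Lemma smooth_formD w1 w2 : smooth_form w1 -> smooth_form w2 ->
  smooth_form (fun q => w1 q + w2 q).
Proof.
by move=> C1 C2 S; apply: eq_smooth (smoothD (C1 S) (C2 S)) => q _; rewrite ffunE.
Qed.

Lemma smooth_formZ f w : smooth_interior u f -> smooth_form w ->
  smooth_form (fun q => f q *: w q).
Proof.
by move=> fC wC S; apply: eq_smooth (smoothM fC (wC S)) => q _; rewrite ffunE.
Qed.

Lemma smooth_form_sum (I : finType) (F : I -> T -> X) :
  (forall i, smooth_form (F i)) -> smooth_form (fun q => \sum_i F i q).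
Proof.
move=> FC S; apply: eq_smooth (smooth_sum (fun=> true) (fun i => FC i S)) => q _.
by rewrite sum_ffunE.
Qed.

Lemma smooth_emul_basis a w : smooth_form w -> smooth_form (fun q => emul_basis a (w q)).
Proof.
move=> wC S; have [aS|aS] := boolP (a \in S).
  apply: eq_smooth (smoothM (smooth_cst u (koszul_sign R a (S :\ a)%SET)) (wC _)) => q _.
  by rewrite ffunE aS.
by apply: eq_smooth (smooth_cst u 0) => q _; rewrite ffunE (negbTE aS).
Qed.

Lemma smooth_imul_basis a w : smooth_form w -> smooth_form (fun q => imul_basis a (w q)).
Proof.
move=> wC S; have [aS|aS] := boolP (a \in S).
  by apply: eq_smooth (smooth_cst u 0) => q _; rewrite ffunE aS.
apply: eq_smooth (smoothM (smooth_cst u (koszul_sign R a S)) (wC _)) => q _.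
by rewrite ffunE (negbTE aS).
Qed.

Lemma smooth_pd_form a w : smooth_form w -> smooth_form (pd_form a w).
Proof. by move=> wC S; apply: eq_smooth (smooth_pd a (wC S)) => q _; rewrite ffunE. Qed.

Lemma smooth_emul (v : T -> 'rV[R]_n.+1) w : smooth_mx u v -> smooth_form w ->
  smooth_form (fun q => emul (v q) (w q)).
Proof.
move=> vC wC; apply: smooth_form_sum => a.
by apply: smooth_formZ => //; exact: smooth_emul_basis.
Qed.

Lemma smooth_interior_mul (v : T -> 'rV[R]_n.+1) w : smooth_mx u v -> smooth_form w ->
  smooth_form (fun q => interior_mul (v q) (w q)).
Proof.
move=> vC wC; apply: smooth_form_sum => a.
by apply: smooth_formZ => //; exact: smooth_imul_basis.
Qed.

Lemma smooth_derivation (M : T -> 'M[R]_n.+1) w : smooth_mx u M -> smooth_form w ->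
  smooth_form (fun q => derivation (M q) (w q)).
Proof.
move=> MC wC; apply: smooth_form_sum => a; apply: smooth_form_sum => b.
by apply: smooth_formZ => //; apply: smooth_emul_basis; exact: smooth_imul_basis.
Qed.

Lemma pd_formD a w1 w2 p : smooth_form w1 -> smooth_form w2 -> inner p ->
  pd_form a (fun q => w1 q + w2 q) p = pd_form a w1 p + pd_form a w2 p.
Proof.
move=> C1 C2 Hp; apply/ffunP => S; rewrite !ffunE -pdD //.
by apply: eq_pd => // q _; rewrite ffunE.
Qed.

Lemma pd_formZ a f w p : smooth_interior u f -> smooth_form w -> inner p ->
  pd_form a (fun q => f q *: w q) p = f p *: pd_form a w p + pd u a f p *: w p.
Proof.
move=> fC wC Hp; apply/ffunP => S; rewrite !ffunE -[RHS](pdM a fC (wC S)) //.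
by apply: eq_pd => // q _; rewrite ffunE.
Qed.

Lemma pd_form_sum (I : finType) (F : I -> T -> X) a p :
  (forall i, smooth_form (F i)) -> inner p ->
  pd_form a (fun q => \sum_i F i q) p = \sum_i pd_form a (F i) p.
Proof.
move=> FC Hp; apply/ffunP => S; rewrite ffunE sum_ffunE.
rewrite (@eq_pd _ _ _ _ _ _ (fun q => \sum_i F i q S)) //; last first.
  by move=> q _; rewrite sum_ffunE.
rewrite pd_sum //; last by move=> i; exact: FC.
by apply: eq_bigr => i _; rewrite ffunE.
Qed.

Lemma pd_emul_basis a b w p : smooth_form w -> inner p ->
  pd_form a (fun q => emul_basis b (w q)) p = emul_basis b (pd_form a w p).
Proof.
move=> wC Hp; apply/ffunP => S; rewrite !ffunE.
have [bS|bS] := boolP (b \in S).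
  by rewrite -pdZ //; apply: eq_pd => // q _; rewrite ffunE bS.
by rewrite -[RHS](pd_cst a 0 Hp); apply: eq_pd => // q _; rewrite ffunE (negbTE bS).
Qed.

Lemma pd_imul_basis a b w p : smooth_form w -> inner p ->
  pd_form a (fun q => imul_basis b (w q)) p = imul_basis b (pd_form a w p).
Proof.
move=> wC Hp; apply/ffunP => S; rewrite !ffunE.
have [bS|bS] := boolP (b \in S).
  by rewrite -[RHS](pd_cst a 0 Hp); apply: eq_pd => // q _; rewrite ffunE bS.
by rewrite -pdZ //; apply: eq_pd => // q _; rewrite ffunE (negbTE bS).
Qed.

Lemma pd_emul a (v : T -> 'rV[R]_n.+1) w p :
  smooth_mx u v -> smooth_form w -> inner p ->
  pd_form a (fun q => emul (v q) (w q)) p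
  = emul (pd_mx u a v p) (w p) + emul (v p) (pd_form a w p).
Proof.
move=> vC wC Hp; rewrite /emul pd_form_sum //; last first.
  by move=> b; apply: smooth_formZ => //; exact: smooth_emul_basis.
rewrite -big_split; apply: eq_bigr => b _ /=.
rewrite pd_formZ //; last exact: smooth_emul_basis.
by rewrite pd_emul_basis // mxE addrC.
Qed.

Lemma pd_interior_mul a (v : T -> 'rV[R]_n.+1) w p :
  smooth_mx u v -> smooth_form w -> inner p ->
  pd_form a (fun q => interior_mul (v q) (w q)) p
  = interior_mul (pd_mx u a v p) (w p) + interior_mul (v p) (pd_form a w p).
Proof.
move=> vC wC Hp; rewrite /interior_mul pd_form_sum //; last first.
  by move=> b; apply: smooth_formZ => //; exact: smooth_imul_basis.
rewrite -big_split; apply: eq_bigr => b _ /=.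
rewrite pd_formZ //; last exact: smooth_imul_basis.
by rewrite pd_imul_basis // mxE addrC.
Qed.

End FormCalculus.

Section LeviCivita.
Variables (R : realType) (n : nat) (T : topologicalType) (u : chart R n T).
Variable G : T -> 'M[R]_n.+1.
Notation X := (ext_form R n).
Notation inner := (interior_dom u).
Hypothesis Gsmooth : smooth_mx u G.
Hypothesis Gsym : forall q, inner q -> (G q)^T = G q.
Hypothesis Gunit : forall q, inner q -> G q \in unitmx.
Implicit Types (a b c : 'I_n.+1) (p q : T) (w : T -> X) (f : T -> R).
Notation Gi q := (invmx (G q)).

(** Rows carry the lower index, so that this is the matrix whose [derivation] is subtracted in the
    covariant derivative along a. *)
Definition christoffel_mx a q : 'M[R]_n.+1 := \matrix_(b, c) christoffel u G c a b q.

Lemma invmx_sym q : inner q -> (Gi q)^T = Gi q.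
Proof. by move=> Hq; rewrite trmx_inv Gsym. Qed.

Lemma pd_metric_sym a b c q : inner q ->
  pd u a (fun q => G q b c) q = pd u a (fun q => G q c b) q.
Proof.
by move=> Hq; apply: eq_pd => // r Hr; rewrite -[in LHS](Gsym Hr) mxE.
Qed.

Lemma christoffel_sym a b c q : inner q ->
  christoffel u G c a b q = christoffel u G c b a q.
Proof.
move=> Hq; congr (_ * _); apply: eq_bigr => e _; congr (_ * _).
by rewrite (pd_metric_sym e a b Hq); congr (_ - _); rewrite addrC.
Qed.

Lemma smooth_christoffel a b c : smooth_interior u (christoffel u G c a b).
Proof.
apply: smoothM; first exact: smooth_cst; apply: smooth_sum => e.
apply: smoothM; first exact: smooth_invmx.
by apply: smoothB; [apply: smoothD|]; exact: smooth_pd.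
Qed.

Lemma smooth_christoffel_mx a : smooth_mx u (christoffel_mx a).
Proof.
move=> b c; apply: eq_smooth (smooth_christoffel a b c) => q _.
by rewrite mxE.
Qed.

Definition lowered_christoffel a q : 'M[R]_n.+1 := \matrix_(b, e)
  (2^-1 * (pd u a (fun q => G q e b) q + pd u b (fun q => G q e a) q
     - pd u e (fun q => G q a b) q)).

Lemma christoffel_mxE a q : inner q ->
  christoffel_mx a q = lowered_christoffel a q *m Gi q.
Proof.
move=> Hq; apply/matrixP => b c; rewrite !mxE /christoffel mulr_sumr; apply: eq_bigr => e _.
by rewrite !mxE -mulrA; congr (_ * _); rewrite mulrC -[in RHS](invmx_sym Hq) mxE.
Qed.

(** The right-hand side is the lowered Christoffel matrix plus its transpose. Of the three
    derivatives in it, the last two are antisymmetric in the matrix indices and cancel. *)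
Lemma metric_compat a p : inner p ->
  pd_mx u a G p = christoffel_mx a p *m G p + G p *m (christoffel_mx a p)^T.
Proof.
move=> Hp; rewrite christoffel_mxE // -mulmxA mulVmx ?Gunit // mulmx1.
rewrite trmx_mul invmx_sym // mulmxA mulmxV ?Gunit // mul1mx.
apply/matrixP => b c; rewrite !mxE (pd_metric_sym a c b Hp) (pd_metric_sym b c a Hp)
  (pd_metric_sym c b a Hp).
by rewrite -mulrDr; field.
Qed.

Lemma pd_inverse_metric a p : inner p ->
  pd_mx u a (fun q => Gi q) p
  = - (Gi p *m christoffel_mx a p + (christoffel_mx a p)^T *m Gi p).
Proof.
move=> Hp; rewrite pd_mx_inv // metric_compat // mulmxDr mulmxDl; congr (- (_ + _)).
  by rewrite mulmxA mulmxK // Gunit.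
by rewrite !mulmxA mulVmx ?Gunit // mul1mx.
Qed.

Definition covariant_pd (v : T -> 'rV[R]_n.+1) a p : 'rV[R]_n.+1 :=
  pd_mx u a v p - v p *m (christoffel_mx a p)^T.

(** The left-hand side is the covariant derivative of the vector field obtained from v, so this says
    that raising an index commutes with the connection. *)
Lemma raise_covariant_pd (v : T -> 'rV[R]_n.+1) a p : smooth_mx u v -> inner p ->
  pd_mx u a (fun q => v q *m Gi q) p + (v p *m Gi p) *m christoffel_mx a p
  = covariant_pd v a p *m Gi p.
Proof.
move=> vC Hp; rewrite pd_mxM //; last exact: smooth_invmx.
by rewrite pd_inverse_metric // /covariant_pd mulmxN mulmxDr mulmxBl !mulmxA opprD
  addrA addrAC addrNK.
Qed.

Lemma nablaE a w p :
  nabla u G a w p = pd_form u a w p - derivation (christoffel_mx a p) (w p).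
Proof.
congr (_ - _); apply: eq_bigr => b _; apply: eq_bigr => c _.
by rewrite mxE.
Qed.

Lemma smooth_nabla a w : smooth_form u w -> smooth_form u (nabla u G a w).
Proof.
move=> wC; apply: (@eq_smooth_form _ _ _ _ (fun q => pd_form u a w q
   + (-1) *: derivation (christoffel_mx a q) (w q))).
  by move=> q _; rewrite nablaE scaleN1r.
apply: smooth_formD; first exact: smooth_pd_form.
apply: smooth_formZ; first exact: smooth_cst.
by apply: smooth_derivation => //; exact: smooth_christoffel_mx.
Qed.

Lemma smooth_extd w : smooth_form u w -> smooth_form u (extd u G w).
Proof.
move=> wC; apply: smooth_form_sum => a; apply: smooth_emul_basis.
exact: smooth_nabla.
Qed.

Lemma smooth_codiff w : smooth_form u w -> smooth_form u (codiff u G w).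
Proof.
move=> wC; apply: smooth_form_sum => a; apply: smooth_form_sum => b.
apply: smooth_formZ; first exact: smooth_invmx.
by apply: smooth_imul_basis; exact: smooth_nabla.
Qed.

Lemma eq_nabla a w1 w2 p : (forall q, inner q -> w1 q = w2 q) -> inner p ->
  nabla u G a w1 p = nabla u G a w2 p.
Proof. by move=> ew Hp; rewrite !nablaE (eq_pd_form a ew Hp) ew. Qed.

Lemma eq_extd w1 w2 p : (forall q, inner q -> w1 q = w2 q) -> inner p ->
  extd u G w1 p = extd u G w2 p.
Proof. by move=> ew Hp; apply: eq_bigr => a _; rewrite (eq_nabla a ew Hp). Qed.

Lemma eq_codiff w1 w2 p : (forall q, inner q -> w1 q = w2 q) -> inner p ->
  codiff u G w1 p = codiff u G w2 p.
Proof.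
move=> ew Hp; apply: eq_bigr => a _; apply: eq_bigr => b _.
by rewrite (eq_nabla b ew Hp).
Qed.

Lemma nablaD a w1 w2 p : smooth_form u w1 -> smooth_form u w2 -> inner p ->
  nabla u G a (fun q => w1 q + w2 q) p = nabla u G a w1 p + nabla u G a w2 p.
Proof. by move=> C1 C2 Hp; rewrite !nablaE pd_formD // linearD opprD addrACA. Qed.

Lemma extdD w1 w2 p : smooth_form u w1 -> smooth_form u w2 -> inner p ->
  extd u G (fun q => w1 q + w2 q) p = extd u G w1 p + extd u G w2 p.
Proof.
move=> C1 C2 Hp; rewrite /extd -big_split; apply: eq_bigr => a _.
by rewrite nablaD // linearD.
Qed.

Lemma codiffD w1 w2 p : smooth_form u w1 -> smooth_form u w2 -> inner p ->
  codiff u G (fun q => w1 q + w2 q) p = codiff u G w1 p + codiff u G w2 p.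
Proof.
move=> C1 C2 Hp; rewrite /codiff -big_split; apply: eq_bigr => a _.
by rewrite -big_split; apply: eq_bigr => b _; rewrite nablaD // linearD scalerDr.
Qed.

Lemma nablaZ a f w p : smooth_interior u f -> smooth_form u w -> inner p ->
  nabla u G a (fun q => f q *: w q) p = f p *: nabla u G a w p + pd u a f p *: w p.
Proof.
by move=> fC wC Hp; rewrite !nablaE pd_formZ // linearZ scalerBr addrAC.
Qed.

Lemma extdZ f w p : smooth_interior u f -> smooth_form u w -> inner p ->
  extd u G (fun q => f q *: w q) p = f p *: extd u G w p + emul (grad_at u f p) (w p).
Proof.
move=> fC wC Hp; rewrite /extd /emul scaler_sumr -big_split; apply: eq_bigr => a _.
by rewrite nablaZ // linearD !linearZ /= mxE.
Qed.

Lemma codiffZ f w p : smooth_interior u f -> smooth_form u w -> inner p ->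
  codiff u G (fun q => f q *: w q) p
  = f p *: codiff u G w p + interior_mul (grad_at u f p *m Gi p) (w p).
Proof.
move=> fC wC Hp; rewrite /codiff /interior_mul scaler_sumr -big_split.
apply: eq_bigr => a _ /=; rewrite scaler_sumr mxE scaler_suml -big_split.
apply: eq_bigr => b _ /=; rewrite nablaZ // linearD !linearZ /= scalerDr !scalerA.
by rewrite mxE -[in X in _ + X](invmx_sym Hp) mxE; congr (_ *: _ + _ *: _); rewrite mulrC.
Qed.

Lemma nabla_emul a (v : T -> 'rV[R]_n.+1) w p :
  smooth_mx u v -> smooth_form u w -> inner p ->
  nabla u G a (fun q => emul (v q) (w q)) p
  = emul (covariant_pd v a p) (w p) + emul (v p) (nabla u G a w p).
Proof.
move=> vC wC Hp; rewrite !nablaE pd_emul // derivation_emul /covariant_pd linearB /=.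
by rewrite emulB opprD [X in _ + X]addrC addrACA.
Qed.

Lemma nabla_interior_mul a (v : T -> 'rV[R]_n.+1) w p :
  smooth_mx u v -> smooth_form u w -> inner p ->
  nabla u G a (fun q => interior_mul (v q *m Gi q) (w q)) p
  = interior_mul (covariant_pd v a p *m Gi p) (w p)
    + interior_mul (v p *m Gi p) (nabla u G a w p).
Proof.
move=> vC wC Hp; have VC : smooth_mx u (fun q => v q *m Gi q).
  by apply: smooth_mxM => //; exact: smooth_invmx.
rewrite !nablaE pd_interior_mul // derivation_interior_mul.
by rewrite -raise_covariant_pd // interior_mulDl (linearB (interior_mul (v p *m _))) opprB addrACA.
Qed.

(* Cartan's formula, with the Lie derivative expressed by the Levi-Civita
   connection. *)
Lemma cartan (v : T -> 'rV[R]_n.+1) w p :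
  smooth_mx u v -> smooth_form u w -> inner p ->
  let V q := v q *m Gi q in
  interior_mul (V p) (extd u G w p) + extd u G (fun q => interior_mul (V q) (w q)) p
  = \sum_a V p 0 a *: nabla u G a w p
    + derivation ((\matrix_(a, b) covariant_pd v a p 0 b) *m Gi p) (w p).
Proof.
move=> vC wC Hp V; rewrite /extd linear_sum -big_split -big_split.
apply: eq_bigr => a _ /=; rewrite nabla_interior_mul //.
(* Moving i(V) past dx^a produces V^a nabla_a w; what is left cancels the part of d (i(V) w) in
   which the derivative falls on w. *)
rewrite interior_mul_emul_basis (linearD (emul_basis a)) /=.
rewrite -/(V p) [X in _ + X]addrC addrA addrNK; congr (_ + _).
rewrite /interior_mul linear_sum; apply: eq_bigr => b _.
rewrite linearZ /= !mxE; congr (_ *: _); apply: eq_bigr => c _.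
by rewrite !mxE.
Qed.

(** Contraction is moved past the factor v in both terms of the Leibniz rule: with nabla v this
    yields the trace and the transposed derivation, with nabla w the derivative along the raised v
    and the divergence of w. *)
Lemma codiff_emul (v : T -> 'rV[R]_n.+1) w p :
  smooth_mx u v -> smooth_form u w -> inner p ->
  let H : 'M[R]_n.+1 := \matrix_(a, b) covariant_pd v a p 0 b in
  codiff u G (fun q => emul (v q) (w q)) p
  = metric_trace (G p) H *: w p - derivation (H^T *m Gi p) (w p)
    + \sum_a (v p *m Gi p) 0 a *: nabla u G a w p - emul (v p) (codiff u G w p).
Proof.
move=> vC wC Hp H.
have GiE a b : Gi p a b = Gi p b a by rewrite -[in LHS](invmx_sym Hp) mxE.
have [N NE] : exists N, forall b, nabla u G b w p = N b.
  by exists (fun b => nabla u G b w p).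
rewrite /codiff.
under eq_bigr => a _ do under eq_bigr => b _ do
  rewrite nabla_emul // NE (linearD (imul_basis a)) /= !imul_basis_emul !scalerDr !scalerN !scalerA.
under eq_bigr do rewrite !big_split /=.
rewrite !big_split /= -!addrA; congr (_ + (_ + (_ + _))).
- rewrite scaler_suml exchange_big /=; apply: eq_bigr => a _; rewrite scaler_suml.
  by apply: eq_bigr => b _; rewrite [in LHS]GiE [H _ _]mxE.
- rewrite /derivation exchange_big /=; under eq_bigr do rewrite sumrN.
  rewrite sumrN; congr (- _).
  have e a b : Gi p a b *: emul (covariant_pd v b p) (imul_basis a (w p))
      = \sum_c (Gi p a b * covariant_pd v b p 0 c) *: emul_basis c (imul_basis a (w p)).
    by rewrite /emul scaler_sumr; apply: eq_bigr => c _; rewrite scalerA.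
  transitivity (\sum_b \sum_a \sum_c
    (Gi p a b * covariant_pd v b p 0 c) *: emul_basis c (imul_basis a (w p))).
    by apply: eq_bigr => b _; apply: eq_bigr => a _; exact: e.
  transitivity (\sum_b \sum_c \sum_a
    (Gi p a b * covariant_pd v b p 0 c) *: emul_basis c (imul_basis a (w p))).
    by apply: eq_bigr => b _; exact: exchange_big.
  rewrite exchange_big /=; apply: eq_bigr => c _; rewrite exchange_big /=.
  apply: eq_bigr => a _; rewrite [(_ *m _) _ _]mxE scaler_suml; apply: eq_bigr => b _.
  by rewrite [H^T _ _]mxE [H _ _]mxE [in LHS]GiE mulrC.
- rewrite exchange_big /=; apply: eq_bigr => b _; rewrite mxE scaler_suml.
  by apply: eq_bigr => a _; rewrite NE mulrC.
- rewrite (linear_sum (emul (v p))) -sumrN; apply: eq_bigr => a _ /=.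
  rewrite (linear_sum (emul (v p))) -sumrN; apply: eq_bigr => b _ /=.
  by rewrite NE [emul _ (_ *: _)]linearZ.
Qed.

Definition hessian f p : 'M[R]_n.+1 :=
  \matrix_(a, b) (pd u a (pd u b f) p - \sum_c christoffel u G c a b p * pd u c f p).

Lemma box_at_hessian f p : box_at u G f p = metric_trace (G p) (hessian f p).
Proof. by apply: eq_bigr => a _; apply: eq_bigr => b _; rewrite mxE. Qed.

Lemma hessian_sym f p : smooth_interior u f -> inner p -> (hessian f p)^T = hessian f p.
Proof.
move=> fC Hp; apply/matrixP => a b; rewrite !mxE pd_swap //; congr (_ - _).
by apply: eq_bigr => c _; rewrite christoffel_sym.
Qed.

Lemma smooth_grad f : smooth_interior u f -> smooth_mx u (grad_at u f).
Proof.
by move=> fC i a; apply: eq_smooth (smooth_pd a fC) => q _; rewrite mxE.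
Qed.

Lemma covariant_pd_grad f p a : inner p ->
  covariant_pd (grad_at u f) a p = row a (hessian f p).
Proof.
move=> Hp; apply/rowP => b; rewrite !mxE; congr (_ - _).
  by apply: eq_pd => // q _; rewrite mxE.
by apply: eq_bigr => c _; rewrite !mxE mulrC.
Qed.

(** The two products of df with delta w cancel. The covariant derivative along grad f, left over
    from [codiff_emul], is removed by [cartan]; this accounts for the factors 2 and for the second
    copy of the Hessian action. *)
Lemma form_laplacianZ f w p :
  smooth_interior u f -> smooth_form u w -> inner p ->
  let i q := interior_mul (grad_at u f q *m Gi q) in
  form_laplacian u G (fun q => f q *: w q) p
  = f p *: form_laplacian u G w p + 2 *: extd u G (fun q => i q (w q)) p
    + 2 *: i p (extd u G w p) + box_at u G f p *: w p
    - 2 *: derivation (hessian f p *m Gi p) (w p).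
Proof.
move=> fC wC Hp i; have gC := smooth_grad fC.
have VC : smooth_mx u (fun q => grad_at u f q *m Gi q).
  by apply: smooth_mxM => //; exact: smooth_invmx.
have dC := smooth_extd wC; have cC := smooth_codiff wC.
have iC : smooth_form u (fun q => i q (w q)) by exact: smooth_interior_mul.
rewrite /form_laplacian.
rewrite (eq_extd (w2 := fun q => f q *: codiff u G w q + i q (w q))) //; last first.
  by move=> q Hq; exact: codiffZ.
rewrite (eq_codiff (w2 := fun q => f q *: extd u G w q + emul (grad_at u f q) (w q)))
  //; last by move=> q Hq; exact: extdZ.
rewrite extdD //; last exact: smooth_formZ.
rewrite codiffD //; [|exact: smooth_formZ|exact: smooth_emul].
rewrite extdZ // codiffZ // codiff_emul //.
have -> : \matrix_(a, b) covariant_pd (grad_at u f) a p 0 b = hessian f p.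
  by apply/row_matrixP => a; rewrite rowK covariant_pd_grad //; apply/rowP => b; rewrite !mxE.
rewrite hessian_sym // -box_at_hessian.
have := cartan gC wC Hp.
have -> : \matrix_(a, b) covariant_pd (grad_at u f) a p 0 b = hessian f p.
  by apply/row_matrixP => a; rewrite rowK covariant_pd_grad //; apply/rowP => b; rewrite !mxE.
rewrite /= -/(i p).
move: (\sum_a _) (derivation _ _) (extd u G (fun q => i q (w q)) p) (i p _) => N D E I.
move=> /esym/(canRL (addrK _)) ->.
move: (extd u G (codiff u G w) p) (codiff u G (extd u G w) p) (emul _ _) (f p)
  (box_at u G f p) (w p) => x y z r s t.
by apply/ffunP => S; rewrite !ffunE /GRing.scale /=; ring.
Qed.

End LeviCivita.

(** * Conformal change of the Ricci tensor *)

(* Pointwise: Gam stands for the Christoffel symbols of g, U for the gradient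
   d log Om of the conformal factor of Om^2 g, V for U with its index raised, and
   dg, dU, dV for the partial derivatives of their components. *)
Section RicciSum.
Variables (R : comRingType) (I : finType).
Implicit Types (a b c e f : I) (F X : I -> R).

Lemma sum_deltal F a : \sum_b (b == a)%:R * F b = F a.
Proof.
rewrite (bigD1 a) //= eqxx mul1r big1 ?addr0 // => b /negbTE ->.
by rewrite mul0r.
Qed.

Lemma sum_deltar F a : \sum_b (a == b)%:R * F b = F a.
Proof. by under eq_bigr do rewrite eq_sym; exact: sum_deltal. Qed.

Variables (Gam : I -> I -> I -> R) (U V : I -> R) (g : I -> I -> R).
Variables (dU dV : I -> I -> R) (dg : I -> I -> I -> R).
Hypothesis Gam_sym : forall c a b, Gam c a b = Gam c b a.
Hypothesis dU_sym : forall a b, dU a b = dU b a.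
Hypothesis g_sym : forall a b, g a b = g b a.
Hypothesis gV : forall e, \sum_a g a e * V a = U e.
Hypothesis dgV : forall b e, \sum_a (dg b a e * V a + g a e * dV b a) = dU b e.
Hypothesis compat : forall a b e,
  dg a b e = \sum_f (Gam f a b * g f e + Gam f a e * g b f).

(** The tensor by which the Christoffel symbols of Om^2 g exceed those of g. *)
Definition conformal_shift c a b : R :=
  (c == a)%:R * U b + (c == b)%:R * U a - g a b * V c.

Definition pd_conformal_shift a c b e : R :=
  (c == b)%:R * dU a e + (c == e)%:R * dU a b - (dg a b e * V c + g b e * dV a c).

Local Notation S := conformal_shift.
Local Notation dS := pd_conformal_shift.
Local Notation N := (#|I|%:R : R).
Local Notation U2 := (\sum_f U f * V f).

Lemma sum_shift_upper X b e :
  \sum_f X f * S f b e = X b * U e + X e * U b - g b e * \sum_f X f * V f.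
Proof.
rewrite -[X b * _](sum_deltal (fun f => X f * U e) b).
rewrite -[X e * _](sum_deltal (fun f => X f * U b) e).
rewrite mulr_sumr -big_split -sumrB; apply: eq_bigr => f _ /=.
by rewrite /S; ring.
Qed.

Lemma sum_shift_lower X a b :
  \sum_f S a b f * X f
  = (a == b)%:R * (\sum_f U f * X f) + X a * U b - V a * \sum_f g b f * X f.
Proof.
rewrite -[X a * _](sum_deltar (fun f => X f * U b) a).
rewrite !mulr_sumr -big_split -sumrB; apply: eq_bigr => f _ /=.
by rewrite /S; ring.
Qed.

Lemma shift_sym c a b : S c a b = S c b a.
Proof. by rewrite /S g_sym; ring. Qed.

Lemma sum_shift_trace f : \sum_a S a a f = N * U f.
Proof.
rewrite (eq_bigr (fun a => U f + ((a == f)%:R * U a - g a f * V a))); last first.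
  by move=> a _; rewrite /S eqxx mul1r; ring.
rewrite big_split /= sumrB sum_deltal gV subrr addr0 sumr_const.
by rewrite mulr_natl.
Qed.

(** The classical formula Ric - (N - 2) (nabla U - U U) - (div U + (N - 2) |U|^2) g in dimension N.
    The products of [Gam] with the shift either cancel or complete dU and dV to covariant
    derivatives. *)
Lemma ricci_sum_conformal (dGam : I -> I -> I -> I -> R) b e :
  let Gh c a b := Gam c a b + S c a b in
  \sum_a (dGam a a b e + dS a a b e - (dGam b a a e + dS b a a e)
     + \sum_f (Gh a a f * Gh f b e - Gh a b f * Gh f a e))
  = \sum_a (dGam a a b e - dGam b a a e
     + \sum_f (Gam a a f * Gam f b e - Gam a b f * Gam f a e))
    - (N - 2) * (dU b e - (\sum_f Gam f b e * U f) - U b * U e)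
    - g b e * (\sum_a (dV a a + \sum_f Gam a a f * V f) + (N - 2) * U2).
Proof.
move=> Gh.
(* [h1] and [h2] evaluate the differentiated shifts; [k1] to [k6] evaluate the six products that
   remain when the old curvature is subtracted. *)
have h1 : \sum_a dS a a b e
    = dU b e + dU e b - \sum_a dg a b e * V a - g b e * \sum_a dV a a.
  rewrite -{1}(sum_deltal (fun a => dU a e) b) -{1}(sum_deltal (fun a => dU a b) e).
  rewrite mulr_sumr -big_split -!sumrB; apply: eq_bigr => a _ /=.
  by rewrite /dS; ring.
have h2 : \sum_a dS b a a e = N * dU b e.
  rewrite (eq_bigr (fun a => dU b e + ((a == e)%:R * dU b a
      - (dg b a e * V a + g a e * dV b a)))); last first.
    by move=> a _; rewrite /dS eqxx mul1r; ring.
  by rewrite big_split /= sumrB sum_deltal dgV subrr addr0 sumr_const mulr_natl.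
pose t f := \sum_a Gam a a f.
have k1 : \sum_a \sum_f Gam a a f * S f b e
    = t b * U e + t e * U b - g b e * \sum_a \sum_f Gam a a f * V f.
  rewrite exchange_big /=.
  rewrite (eq_bigr (fun f => t f * S f b e)); last by move=> f _; rewrite mulr_suml.
  rewrite sum_shift_upper; congr (_ - _ * _); rewrite exchange_big /=.
  by apply: eq_bigr => f _; rewrite mulr_suml.
have k2 : \sum_a \sum_f S a a f * Gam f b e = N * \sum_f Gam f b e * U f.
  rewrite exchange_big mulr_sumr; apply: eq_bigr => f _ /=.
  by rewrite -mulr_suml sum_shift_trace; ring.
have k3 : \sum_a \sum_f S a a f * S f b e = N * (2 * (U b * U e) - g b e * U2).
  rewrite exchange_big /=.
  rewrite (eq_bigr (fun f => N * (U f * S f b e))).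
    by rewrite -mulr_sumr sum_shift_upper; ring.
  by move=> f _; rewrite -mulr_suml sum_shift_trace mulrA.
have k4 : \sum_a \sum_f Gam a b f * S f a e
    = t b * U e + \sum_f Gam f b e * U f - \sum_a \sum_f g a e * (Gam a b f * V f).
  rewrite /t mulr_suml -big_split -sumrB; apply: eq_bigr => a _ /=.
  by rewrite sum_shift_upper -mulr_sumr (Gam_sym a b a).
have k5 : \sum_a \sum_f S a b f * Gam f a e
    = \sum_f Gam f b e * U f + t e * U b - \sum_a \sum_f V a * (g b f * Gam f a e).
  rewrite -[\sum_f Gam f b e * U f](sum_deltal (fun a => \sum_f Gam f a e * U f) b).
  rewrite /t mulr_suml -big_split -sumrB; apply: eq_bigr => a _ /=.
  rewrite sum_shift_lower -mulr_sumr; congr (_ * _ + _ - _).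
  by apply: eq_bigr => f _; rewrite mulrC.
have gV' b' : \sum_f g b' f * V f = U b'.
  by rewrite -gV; apply: eq_bigr => f _; rewrite g_sym.
have k6 : \sum_a \sum_f S a b f * S f a e
    = N * (U b * U e) + 2 * (U b * U e) - 2 * (g b e * U2).
  rewrite (eq_bigr (fun a => S a a b * U e + U a * S a b e
      - (a == b)%:R * (g a e * U2))); last first.
    move=> a _; rewrite sum_shift_upper sum_shift_lower gV' (shift_sym a b a).
    by ring.
  rewrite sumrB big_split /= -mulr_suml sum_shift_trace sum_shift_upper.
  by rewrite sum_deltal; ring.
(* By metric compatibility, the derivatives of g left by [h1] cancel the two double sums left by
   [k4] and [k5]. *)
have k7 : \sum_a dg a b e * V a
    = \sum_a \sum_f g a e * (Gam a b f * V f) + \sum_a \sum_f V a * (g b f * Gam f a e).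
  rewrite [X in _ = X + _]exchange_big -big_split; apply: eq_bigr => a _ /=.
  rewrite compat mulr_suml -big_split; apply: eq_bigr => f _ /=.
  by rewrite (Gam_sym f b a); ring.
rewrite (eq_bigr (fun a => (dGam a a b e - dGam b a a e
     + \sum_f (Gam a a f * Gam f b e - Gam a b f * Gam f a e))
   + (dS a a b e - dS b a a e + (\sum_f Gam a a f * S f b e + \sum_f S a a f * Gam f b e
     + \sum_f S a a f * S f b e - \sum_f Gam a b f * S f a e
     - \sum_f S a b f * Gam f a e - \sum_f S a b f * S f a e)))); last first.
  move=> a _; rewrite -!big_split -!sumrB /=.
  set s1 := \sum_f _; set s2 := \sum_f _; set s3 := \sum_f _.
  have -> : s1 = s2 + s3.
    by rewrite /s1 /s2 /s3 -big_split; apply: eq_bigr => f _ /=; rewrite /Gh; ring.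
  by ring.
rewrite big_split -!addrA; congr (_ + _) => /=.
rewrite big_split /= sumrB.
rewrite 3![in X in _ - _ + X = _]sumrB 2![in X in _ - _ + X = _]big_split /=.
rewrite [in RHS]big_split /= h1 h2 k1 k2 k3 k4 k5 k6 k7 (dU_sym e b).
move: (\sum_f Gam f b e * U f) (\sum_a \sum_f g a e * _) (\sum_a \sum_f V a * _)
  U2 (\sum_a dV a a) (\sum_a \sum_f Gam a a f * V f) => x1 x2 x3 x4 x5 x6.
ring.
Qed.

End RicciSum.

(** * The Einstein equation of s^-2 G expressed in the scale G *)

Section EinsteinScale.
Variables (R : realType) (n : nat) (T : topologicalType) (u : chart R n T).
Variables (G : T -> 'M[R]_n.+1) (s : T -> R).
Notation inner := (interior_dom u).
Hypothesis Gsmooth : smooth_mx u G.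
Hypothesis Gsym : forall q, inner q -> (G q)^T = G q.
Hypothesis Gunit : forall q, inner q -> G q \in unitmx.
Hypothesis ssmooth : smooth_interior u s.
Hypothesis s0 : forall q, inner q -> s q != 0.
Implicit Types (a b c e : 'I_n.+1) (p q : T).
Notation Gi q := (invmx (G q)).
Notation Gam := (christoffel u G).

Definition einstein_metric q : 'M[R]_n.+1 := (s q ^+ 2)^-1 *: G q.

(** The conformal factor from G to s^-2 G is 1/s; this is the gradient of its logarithm for s >
    0. *)
Definition log_grad q : 'rV[R]_n.+1 := - (s q)^-1 *: grad_at u s q.

Local Notation go := einstein_metric.
Local Notation U := log_grad.
Local Notation V q := (U q *m Gi q).

Lemma smooth_log_grad : smooth_mx u U.
Proof.
move=> i a; apply: eq_smooth
  (smoothM (smoothN (smoothV s0 ssmooth)) (smooth_grad ssmooth i a)) => q _.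
by rewrite !mxE ?ord1.
Qed.

Lemma pd_einstein_metric a b e q : inner q ->
  pd u a (fun r => go r b e) q
  = (s q ^+ 2)^-1 * (pd u a (fun r => G r b e) q + 2 * U q 0 a * G q b e).
Proof.
move=> Hq; have s2C : smooth_interior u (fun r => s r ^+ 2).
  by apply: eq_smooth (smoothM ssmooth ssmooth) => r _; rewrite expr2.
have s20 r : inner r -> s r ^+ 2 != 0 by move=> Hr; rewrite expf_neq0 // s0.
rewrite (@eq_pd _ _ _ _ _ _ (fun r => (s r ^+ 2)^-1 * G r b e)) //; last first.
  by move=> r _; rewrite mxE.
rewrite (pdM _ (smoothV s20 s2C) (Gsmooth b e)) // pdV //.
rewrite (@eq_pd _ _ _ _ _ (fun r => s r ^+ 2) (fun r => s r * s r)) //.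
by rewrite pdM // !mxE; have := s0 Hq => sq; field.
Qed.

Lemma christoffel_einstein c a b q : inner q ->
  christoffel u go c a b q
  = Gam c a b q + conformal_shift (U q 0) (V q 0) (fun a b => G q a b) c a b.
Proof.
move=> Hq; have Gq := Gunit Hq.
have GiE i j : Gi q i j = Gi q j i by rewrite -[in LHS](invmx_sym Gsym Hq) mxE.
have GiG e : \sum_i Gi q c i * G q i e = (c == e)%:R.
  by have := congr1 (fun M : 'M[R]_n.+1 => M c e) (mulVmx Gq); rewrite !mxE.
rewrite /christoffel /conformal_shift -(GiG a) -(GiG b).
rewrite [(U q *m Gi q) 0 c]mxE !mulr_suml !mulr_sumr -!big_split -sumrB -big_split; apply: eq_bigr => e _ /=.
have sq := s0 Hq.
rewrite /einstein_metric invmxZ; last by rewrite unitmxZ // unitfE invr_eq0 expf_neq0.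
rewrite -/einstein_metric !pd_einstein_metric // [in LHS]mxE invrK.
have -> : Gi q e c = Gi q c e by exact: GiE.
by field.
Qed.

(** The quadratic term cancels the product U U of the conformal Ricci formula, so that only the
    Hessian of s survives outside the multiples of the metric. *)
Lemma log_grad_hessian a b q : inner q ->
  covariant_pd u G U a q 0 b = - (s q)^-1 * hessian u G s q a b + U q 0 a * U q 0 b.
Proof.
move=> Hq; have sq := s0 Hq.
rewrite /covariant_pd [in LHS]mxE [in X in X + _ = _]mxE.
rewrite (@eq_pd _ _ _ _ _ _ (fun r => - ((s r)^-1 * pd u b s r))) //; last first.
  by move=> r _; rewrite !mxE mulNr.
rewrite pdN ?pdM ?pdV //; try exact: smoothV; try exact: smooth_pd; last first.
  by apply: smoothM; [exact: smoothV|exact: smooth_pd].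
rewrite [X in _ + X](_ : _ = (s q)^-1 * \sum_c Gam c a b q * pd u c s q); last first.
  rewrite mxE mxE mulr_sumr -sumrN; apply: eq_bigr => c _; rewrite !mxE; ring.
by rewrite !mxE; field.
Qed.

Definition grad_norm2 q : R := (grad_at u s q *m Gi q *m (grad_at u s q)^T) 0 0.

(** [ricci_sum_conformal] for the conformal factor 1/s in dimension N = n + 1. The divergence of the
    raised [log_grad] contributes one more |U|^2 to the N - 2 already present, whence the
    coefficient n. *)
Lemma ricci_einstein q : inner q ->
  ricci u go q = ricci u G q + (n%:R - 1) * (s q)^-1 *: hessian u G s q
    + ((s q)^-1 * box_at u G s q - n%:R * (s q)^-1 ^+ 2 * grad_norm2 q) *: G q.
Proof.
move=> Hq; have sq := s0 Hq; have UC := smooth_log_grad.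
have VC : smooth_mx u (fun q => V q) by apply: smooth_mxM => //; exact: smooth_invmx.
have Gqs a b : G q a b = G q b a by rewrite -[in LHS](Gsym Hq) mxE.
have GiE i j : Gi q i j = Gi q j i by rewrite -[in LHS](invmx_sym Gsym Hq) mxE.
have VG r : inner r -> V r *m G r = U r by move=> Hr; rewrite mulmxKV // Gunit.
have gV e : \sum_a G q a e * V q 0 a = U q 0 e.
  by rewrite -[in RHS](VG q Hq) mxE; apply: eq_bigr => a _; rewrite mulrC.
have dUE a b : pd u a (fun r => U r 0 b) q
    = - (s q)^-1 * hessian u G s q a b + U q 0 a * U q 0 b + \sum_c Gam c a b q * U q 0 c.
  rewrite -log_grad_hessian // /covariant_pd [in RHS]mxE [in X in _ = X + _ + _]mxE.
  rewrite -addrA [X in _ = _ + X](_ : _ = 0) ?addr0 // mxE mxE addrC; apply/eqP.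
  rewrite subr_eq0; apply/eqP; apply: eq_bigr => c _; rewrite !mxE; exact: mulrC.
have dUsym a b : pd u a (fun r => U r 0 b) q = pd u b (fun r => U r 0 a) q.
  rewrite !dUE [_ * U q 0 b]mulrC; congr (_ * _ + _ + _).
    by rewrite -[in LHS](hessian_sym Gsym ssmooth Hq) mxE.
  by apply: eq_bigr => c _; rewrite (christoffel_sym Gsym).
have dgV b e : \sum_a (pd u b (fun r => G r a e) q * V q 0 a
    + G q a e * pd u b (fun r => V r 0 a) q) = pd u b (fun r => U r 0 e) q.
  rewrite [RHS](@eq_pd _ _ _ _ _ _ (fun r => \sum_a V r 0 a * G r a e)) //; last first.
    by move=> r Hr; rewrite -[in LHS](VG r Hr) mxE.
  rewrite pd_sum //; last by move=> a; apply: smoothM; [exact: VC|exact: Gsmooth].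
  apply: eq_bigr => a _; rewrite (pdM _ (VC 0 a) (Gsmooth a e)) //; ring.
have compat a b e : pd u a (fun r => G r b e) q
    = \sum_f (Gam f a b q * G q f e + Gam f a e q * G q b f).
  have := congr1 (fun M : 'M[R]_n.+1 => M b e) (metric_compat Gsym Gunit a Hq).
  rewrite /pd_mx mxE => ->; rewrite mxE [in X in X + _ = _]mxE [in X in _ + X = _]mxE.
  by rewrite -big_split; apply: eq_bigr => f _ /=; rewrite !mxE [_ * Gam f a e q]mulrC.
have dchr a c b e : pd u a (christoffel u go c b e) q = pd u a (Gam c b e) q
    + pd_conformal_shift (V q 0) (fun a b => G q a b)
      (fun a b => pd u a (fun r => U r 0 b) q) (fun a b => pd u a (fun r => V r 0 b) q)
      (fun a b e => pd u a (fun r => G r b e) q) a c b e.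
  have C1 := smoothM (smooth_cst u (c == b)%:R) (UC 0 e).
  have C2 := smoothM (smooth_cst u (c == e)%:R) (UC 0 b).
  have C3 := smoothM (Gsmooth b e) (VC 0 c).
  rewrite (@eq_pd _ _ _ _ _ _ (fun r => Gam c b e r + ((c == b)%:R * U r 0 e
    + (c == e)%:R * U r 0 b - G r b e * V r 0 c))) //; last first.
    by move=> r Hr; rewrite christoffel_einstein.
  have C0 : smooth_interior u (Gam c b e) by exact: smooth_christoffel.
  rewrite (pdD _ C0 (smoothB (smoothD C1 C2) C3) Hq).
  rewrite (pdB _ (smoothD C1 C2) C3 Hq) (pdD _ C1 C2 Hq).
  rewrite (pdZ _ _ (UC 0 e) Hq) (pdZ _ _ (UC 0 b) Hq) (pdM _ (Gsmooth b e) (VC 0 c) Hq).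
  by rewrite /pd_conformal_shift; ring.
have trV : \sum_a (pd u a (fun r => V r 0 a) q + \sum_f Gam a a f q * V q 0 f)
    = - (s q)^-1 * box_at u G s q + (s q)^-1 ^+ 2 * grad_norm2 q.
  rewrite box_at_hessian /grad_norm2 /metric_trace mulr_sumr [in RHS]mxE mulr_sumr.
  rewrite -big_split; apply: eq_bigr => a _ /=.
  have := congr1 (fun M : 'rV[R]_n.+1 => M 0 a)
    (raise_covariant_pd Gsmooth Gsym Gunit a UC Hq).
  rewrite mxE [X in X + _]mxE [X in _ + X]mxE [in RHS]mxE => H.
  rewrite (eq_bigr (fun f => V q 0 f * christoffel_mx u G a q f a)); last first.
    by move=> f _; rewrite [christoffel_mx _ _ _ _ _ _]mxE mulrC (christoffel_sym Gsym).
  rewrite H [in RHS]mxE mulr_sumr mulr_suml mulr_sumr -big_split; apply: eq_bigr => f _ /=.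
  by rewrite log_grad_hessian // ![U q 0 _]mxE [_^T _ _]mxE (GiE a f); ring.
have normU : \sum_f U q 0 f * V q 0 f = (s q)^-1 ^+ 2 * grad_norm2 q.
  rewrite /grad_norm2 [in RHS]mxE mulr_sumr; apply: eq_bigr => f _.
  have -> : V q 0 f = - (s q)^-1 * (grad_at u s q *m Gi q) 0 f.
    by rewrite -scalemxAl [LHS]mxE.
  by rewrite [U q 0 f]mxE [_^T _ _]mxE; ring.
apply/matrixP => b e; rewrite [in LHS]mxE.
transitivity (\sum_a (pd u a (Gam a b e) q
   + pd_conformal_shift (V q 0) (fun a b => G q a b)
      (fun a b => pd u a (fun r => U r 0 b) q) (fun a b => pd u a (fun r => V r 0 b) q)
      (fun a b e => pd u a (fun r => G r b e) q) a a b e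
   - (pd u b (Gam a a e) q
   + pd_conformal_shift (V q 0) (fun a b => G q a b)
      (fun a b => pd u a (fun r => U r 0 b) q) (fun a b => pd u a (fun r => V r 0 b) q)
      (fun a b e => pd u a (fun r => G r b e) q) b a a e)
   + \sum_f ((Gam a a f q + conformal_shift (U q 0) (V q 0) (fun a b => G q a b) a a f)
       * (Gam f b e q + conformal_shift (U q 0) (V q 0) (fun a b => G q a b) f b e)
     - (Gam a b f q + conformal_shift (U q 0) (V q 0) (fun a b => G q a b) a b f)
       * (Gam f a e q + conformal_shift (U q 0) (V q 0) (fun a b => G q a b) f a e)))).
  apply: eq_bigr => a _; rewrite !dchr; congr (_ + _); apply: eq_bigr => f _.
  by rewrite !christoffel_einstein.
rewrite (ricci_sum_conformal (Gam := fun c a b => Gam c a b q) _ dUsym Gqs gV dgV compat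
  (fun a c b e => pd u a (Gam c b e) q)); last first.
  by move=> c' a' b'; exact: christoffel_sym.
rewrite trV normU dUE card_ord.
have lin (A B C : 'M[R]_n.+1) (x y : R) :
  (A + x *: B + y *: C) b e = A b e + x * B b e + y * C b e by rewrite !mxE.
by rewrite lin [ricci u G q b e]mxE -(natr1 n); ring.
Qed.

Lemma metric_traceD (g A B : 'M[R]_n.+1) :
  metric_trace g (A + B) = metric_trace g A + metric_trace g B.
Proof.
rewrite /metric_trace -big_split; apply: eq_bigr => a _; rewrite -big_split.
by apply: eq_bigr => b _; rewrite mxE mulrDr.
Qed.

Lemma metric_traceZ (g A : 'M[R]_n.+1) (r : R) :
  metric_trace g (r *: A) = r * metric_trace g A.
Proof.
rewrite /metric_trace mulr_sumr; apply: eq_bigr => a _; rewrite mulr_sumr.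
by apply: eq_bigr => b _; rewrite mxE mulrCA.
Qed.

Lemma metric_trace_self q : inner q -> metric_trace (G q) (G q) = n.+1%:R.
Proof.
move=> Hq; have -> : metric_trace (G q) (G q) = \tr (Gi q *m (G q)^T).
  by apply: eq_bigr => a _; rewrite mxE; apply: eq_bigr => b _; rewrite mxE.
by rewrite Gsym // mulVmx ?Gunit // mxtrace1.
Qed.

(* These are the components of the statement that the scale tractor of an
   Einstein metric is parallel and of unit length. *)
Lemma einstein_hessian q : (2 <= n)%N -> inner q ->
  ricci u go q = - n%:R *: go q ->
  hessian u G s q = - s q *: schouten u G q - rho_at u G s q *: G q /\
  grad_norm2 q + 2 * rho_at u G s q * s q = 1.
Proof.
move=> n2 Hq; have sq := s0 Hq.
have n0 : (n%:R : R) != 0 by rewrite pnatr_eq0 -lt0n (leq_trans _ n2).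
have n10 : (n%:R + 1 : R) != 0 by rewrite natr1 pnatr_eq0.
have n1 : (n%:R - 1 : R) != 0.
  by rewrite subr_eq0 (_ : 1 = 1%:R) // eqr_nat; case: n n2 => [|[|]].
have [RicE trP] := @schouten_spec R n T u G q n2 (Gunit Hq) (Gsym Hq).
rewrite ricci_einstein // RicE /einstein_metric -(natr1 n).
have -> : n%:R + 1 - 2 = n%:R - 1 :> R by ring.
set P := schouten u G q; set H := hessian u G s q; set J := schouten_J u G q.
set B := box_at u G s q; set N2 := grad_norm2 q; move=> E; rewrite -/P -/J in trP.
clear RicE; clearbody P.
(* Solved for P + H / s, the Einstein equation says that this tensor is a multiple of G; taking the
   trace then determines the multiple. *)
have solve (x y J0 b m k : R) (P0 H0 g : 'M[R]_n.+1) :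
    x *: P0 + J0 *: g + (x * y) *: H0 + b *: g = m *: (k *: g) ->
    x *: (P0 + y *: H0) = (m * k - J0 - b) *: g.
  move=> /matrixP E0; apply/matrixP => i j; have := E0 i j; rewrite !mxE => E1.
  by rewrite mulrDr (_ : (m * k - J0 - b) * g i j = m * (k * g i j) - J0 * g i j - b * g i j);
    [rewrite -E1; ring|ring].
have {}E := solve _ _ _ _ _ _ _ _ _ E.
have := congr1 (metric_trace (G q)) E.
rewrite metric_traceZ metric_traceD !metric_traceZ -box_at_hessian -/B trP.
rewrite metric_trace_self // -(natr1 n) => trE.
move: E; set lam := (_ - _ - _) in trE *; move=> E.
have rhoE : (n%:R + 1) * rho_at u G s q = - (B + J * s q).
  by rewrite /rho_at -/B -/J -(natr1 n); field.
have lamE : lam = - (n%:R - 1) * rho_at u G s q * (s q)^-1.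
  apply: (mulIf n10); rewrite -trE mulrAC -[_ * _ * (n%:R + 1)]mulrA.
  rewrite [rho_at _ _ _ _ * _]mulrC rhoE; field.
  exact: sq.
split.
  have : P + (s q)^-1 *: H = (- rho_at u G s q * (s q)^-1) *: G q.
    apply: (scalerI n1); rewrite E lamE scalerA; congr (_ *: _); ring.
  move/(canRL (addKr _))/(congr1 ( *:%R (s q))); rewrite scalerA mulfV // scale1r => ->.
  rewrite scalerDr scalerN scaleNr scalerA mulrCA mulfV // mulr1 scaleNr.
  by [].
(* The multiple [lam] is now known twice: by its definition, which contains |ds|^2, and by the
   trace. The difference is n / s^2 times the norm identity. *)
have E2 : - n%:R * (s q)^-1 ^+ 2 + (n%:R + 1) * rho_at u G s q * (s q)^-1
  + n%:R * (s q)^-1 ^+ 2 * N2 = - (n%:R - 1) * rho_at u G s q * (s q)^-1.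
  by rewrite -lamE /lam rhoE; field.
apply/eqP; rewrite -subr_eq0; apply/eqP; apply: (mulfI n0); rewrite mulr0.
transitivity (s q ^+ 2 * (- n%:R * (s q)^-1 ^+ 2 + (n%:R + 1) * rho_at u G s q * (s q)^-1
  + n%:R * (s q)^-1 ^+ 2 * N2 + (n%:R - 1) * rho_at u G s q * (s q)^-1)).
  by field.
by rewrite E2; ring.
Qed.

End EinsteinScale.

(** * The Proca equations in a chart *)

Section LocalProca.
Variables (R : realType) (n : nat) (T : topologicalType) (u : chart R n T).
Variables (G : T -> 'M[R]_n.+1) (s : T -> R).
Notation X := (ext_form R n).
Notation inner := (interior_dom u).
Hypothesis Gsmooth : smooth_mx u G.
Hypothesis Gsym : forall q, inner q -> (G q)^T = G q.
Hypothesis Gunit : forall q, inner q -> G q \in unitmx.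
Hypothesis ssmooth : smooth_interior u s.
Hypothesis spos : forall q, inner q -> 0 < s q.
Implicit Types (p q : T) (A phi : T -> X) (F : slots R n T).
Notation Gi q := (invmx (G q)).
Notation d := (n.+1%:R : R).
Notation nu q := (interior_mul (grad_at u s q *m Gi q)).
Notation rho q := (rho_at u G s q).

Lemma s_neq0 q : inner q -> s q != 0.
Proof. by move=> /spos; exact: lt0r_neq0. Qed.

Lemma extd_eq0 (w : T -> X) p : (forall q, inner q -> w q = 0) -> inner p ->
  extd u G w p = 0.
Proof.
move=> w0 Hp; have zC := @smooth_form0 R n T u.
(* Writing the zero form as a product makes the Leibniz rule compute its derivative. *)
rewrite (eq_extd G (w2 := fun q => (0 : R) *: (0 : X))) //; last first.
  by move=> q Hq; rewrite w0 // scaler0.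
by rewrite (extdZ G (smooth_cst u 0) zC Hp) scale0r add0r linear0.
Qed.

Lemma codiff_eq0 (w : T -> X) p : (forall q, inner q -> w q = 0) -> inner p ->
  codiff u G w p = 0.
Proof.
move=> w0 Hp; have zC := @smooth_form0 R n T u.
rewrite (eq_codiff G (w2 := fun q => (0 : R) *: (0 : X))) //; last first.
  by move=> q Hq; rewrite w0 // scaler0.
by rewrite (codiffZ Gsym (smooth_cst u 0) zC Hp) scale0r add0r linear0.
Qed.

Lemma form_laplacian_eq0 (w : T -> X) p : (forall q, inner q -> w q = 0) -> inner p ->
  form_laplacian u G w p = 0.
Proof.
move=> w0 Hp; rewrite /form_laplacian extd_eq0 // ?codiff_eq0 ?addr0 //.
  by move=> q Hq; exact: extd_eq0.
by move=> q Hq; exact: codiff_eq0.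
Qed.

Lemma J2P_eq0 (w : T -> X) p : w p = 0 -> J2P u G w p = 0.
Proof. by move=> w0; rewrite /J2P w0 scaler0 derivation_actionE linear0 scaler0 subrr. Qed.

(** Applied to I^* F, this disposes of the summand D I^* of y. The vanishing is assumed on the whole
    open interior because D differentiates. *)
Lemma Dop_eq0 (k : int) (w : R) F p :
  vanishes_on inner F -> inner p -> 
  [/\ north (Dop u G k w F) p = 0, west (Dop u G k w F) p = 0,
      east (Dop u G k w F) p = 0 & south (Dop u G k w F) p = 0].
Proof.
move=> F0 Hp.
have N0 q : inner q -> north F q = 0 by case/F0.
have W0 q : inner q -> west F q = 0 by case/F0.
have E0 q : inner q -> east F q = 0 by case/F0.
have S0 q : inner q -> south F q = 0 by case/F0.
split; rewrite /Dop /=.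
- by rewrite W0 // extd_eq0 // scaler0 subrr scaler0.
- by rewrite extd_eq0 // scaler0.
- rewrite form_laplacian_eq0 // J2P_eq0 ?N0 // codiff_eq0 // extd_eq0 // S0 //.
  by rewrite !(scaler0, addr0, subr0).
- rewrite (extd_eq0 S0) // form_laplacian_eq0 // !J2P_eq0 ?W0 ?extd_eq0 //.
    by rewrite !(scaler0, addr0, subr0).
  by move=> q Hq; rewrite J2P_eq0 ?N0.
Qed.

(* The last equation is the west slot of y A = 0; the remaining slots follow
   from it and the first two equations. *)
Definition reduced_proca (k w : R) A phi : Prop := forall q, inner q ->
  [/\ nu q (A q) = - s q *: phi q, nu q (phi q) = 0,
      codiff u G A q = - (d + w - k) *: phi q, codiff u G phi q = 0 &
      (d + 2 * w - 2) *: (((w + k) * rho q) *: A q + nu q (extd u G A q))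
      = s q *: (form_laplacian u G A q + (w + k) *: J2P u G A q
                + (d + 2 * w) *: extd u G phi q)].

(** * Gradient and Hessian of a power of the scale *)

Section PowerOfScale.
Variable alpha : R.
Notation f := (fun q => s q `^ alpha).

Lemma smooth_scale_power : smooth_interior u f.
Proof. exact: smooth_powR. Qed.

Lemma pd_scale_power a q : inner q -> pd u a f q = alpha * f q * (s q)^-1 * pd u a s q.
Proof.
move=> Hq; rewrite pd_powR //; congr (_ * _); rewrite -mulrA; congr (_ * _).
by rewrite powRB ?(s_neq0 Hq) ?implybT // powRr1 // ltW // spos.
Qed.

Lemma grad_scale_power q : inner q ->
  grad_at u f q = (alpha * f q * (s q)^-1) *: grad_at u s q.
Proof. by move=> Hq; apply/rowP => a; rewrite !mxE pd_scale_power. Qed.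

Lemma hessian_scale_power q : inner q ->
  hessian u G f q = (alpha * f q * (s q)^-1) *: hessian u G s q
    + (alpha * (alpha - 1) * f q * (s q)^-1 ^+ 2) *:
      ((grad_at u s q)^T *m grad_at u s q).
Proof.
move=> Hq; have sq := s_neq0 Hq; have fC := smooth_scale_power.
have iC := smoothV s_neq0 ssmooth.
apply/matrixP => a b; rewrite [LHS]mxE.
rewrite (@eq_pd _ _ _ _ _ _ (fun r => alpha * ((f r * (s r)^-1) * pd u b s r))) //;
  last by move=> r Hr; rewrite pd_scale_power // -!mulrA.
rewrite pdZ //; last by apply: smoothM; [exact: smoothM|exact: smooth_pd].
rewrite (pdM _ (smoothM fC iC) (smooth_pd b ssmooth)) // (pdM _ fC iC) //.
rewrite pd_scale_power // (pdV _ s_neq0) //.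
rewrite [RHS]mxE [(_ *: hessian _ _ _ _) a b]mxE [hessian _ _ _ _ a b]mxE.
rewrite [(_ *: (_ *m _)) a b]mxE [(_ *m _) a b]mxE big_ord1 ![in RHS]mxE.
have -> : \sum_c christoffel u G c a b q * pd u c f q
    = alpha * f q * (s q)^-1 * \sum_c christoffel u G c a b q * pd u c s q.
  by rewrite mulr_sumr; apply: eq_bigr => c _; rewrite pd_scale_power // mulrCA.
by field.
Qed.

End PowerOfScale.

Hypothesis scale_hessian : forall q, inner q ->
  hessian u G s q = - s q *: schouten u G q - rho q *: G q.
Hypothesis scale_norm : forall q, inner q ->
  grad_norm2 u G s q + 2 * rho q * s q = 1.

(** The definition of rho, solved for the Laplacian of s. *)
Lemma box_scale q : box_at u G s q = - (d * rho q + schouten_J u G q * s q).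
Proof.
by rewrite /rho_at mulrA mulrN mulfV ?pnatr_eq0 //; ring.
Qed.

(** With an index raised, the metric part of the Hessian becomes the identity, which acts on k-forms
    as multiplication by k; this is where the form degree enters. *)
Lemma derivation_hessian_scale (k : nat) A q : inner q ->
  (forall S : {set 'I_n.+1}, #|S| != k -> A q S = 0) ->
  derivation (hessian u G s q *m Gi q) (A q)
  = - s q *: derivation_action (G q) (schouten u G q) (A q) - (k%:R * rho q) *: A q.
Proof.
move=> Hq Ak; rewrite scale_hessian // derivation_actionE.
move: (schouten u G q) => P; rewrite mulmxBl -!scalemxAl mulmxV ?Gunit //.
rewrite -[- (rho q *: _)]scaleNr derivationD (derivationZ (- s q)) (derivationZ (- rho q)).
by congr (_ + _); rewrite (derivation1 Ak) scalerA mulNr scaleNr mulrC.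
Qed.

Lemma reduced_procaZ (k : nat) (w0 : R) A phi :
  smooth_form u A -> smooth_form u phi ->
  (forall q, inner q -> forall S : {set 'I_n.+1}, #|S| != k -> A q S = 0) ->
  reduced_proca k%:R w0 A phi ->
  let alpha : R := 1 - (d + 2 * w0) in
  reduced_proca k%:R (- w0 - n%:R) (fun q => s q `^ alpha *: A q)
    (fun q => s q `^ alpha *: phi q).
Proof.
move=> AC phC Ak red alpha q Hq; have sq := s_neq0 Hq.
have fC := smooth_scale_power alpha; pose f r := s r `^ alpha.
have [nuA nuphi deltaA deltaphi west_eq] := red q Hq.
have grad_raised r (x : X) : inner r ->
    interior_mul (grad_at u f r *m Gi r) x = (alpha * f r * (s r)^-1) *: nu r x.
  by move=> Hr; rewrite grad_scale_power // -scalemxAl interior_mulZl.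
have dE : d = n%:R + 1 by rewrite natr1.
split.
- by rewrite linearZ /= nuA !scalerA mulrC.
- by rewrite linearZ /= nuphi scaler0.
(* Here i(df) A = - alpha f phi, which shifts the weight in the divergence equation by exactly
   alpha. *)
- rewrite (codiffZ Gsym fC AC Hq) grad_raised // deltaA nuA !scalerA -scalerDl.
  by congr (_ *: _); rewrite /f; move: (s q `^ alpha) => F; rewrite /alpha dE; field.
- by rewrite (codiffZ Gsym fC phC Hq) grad_raised // deltaphi nuphi !scaler0 addr0.
rewrite (extdZ G fC AC Hq) (extdZ G fC phC Hq) (linearD (nu q)) /=.
rewrite (form_laplacianZ Gsmooth Gsym Gunit fC AC Hq) !grad_raised //.
(* The equation i(nu) A = - s phi holds on an open set, so it may be used under d; the factor 1/s of
   df disappears there. *)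
rewrite (eq_extd G (w1 := fun r => interior_mul (grad_at u f r *m Gi r) (A r))
  (w2 := fun r => (- alpha * f r) *: phi r)) //; last first.
  move=> r Hr; have [nuAr _ _ _ _] := red r Hr.
  have sr := s_neq0 Hr; rewrite grad_raised // nuAr scalerA; congr (_ *: _).
  by move: (f r) => F; field.
rewrite (extdZ G (smoothM (smooth_cst u (- alpha)) fC) phC Hq).
have -> : grad_at u (fun r => - alpha * f r) q = - alpha *: grad_at u f q.
  by apply/rowP => a; rewrite !mxE pdZ.
rewrite grad_scale_power // !emulZ !linearZ /= interior_mul_emul trmx_mul.
rewrite (invmx_sym Gsym Hq) mulmxA -/(grad_norm2 u G s q) nuA.
rewrite hessian_scale_power // mulmxDl -!scalemxAl derivationD !derivationZ.
rewrite -mulmxA derivation_tensor nuA (derivation_hessian_scale Hq (Ak q Hq)).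
have -> : box_at u G f q = (alpha * f q * (s q)^-1) * box_at u G s q
   + (alpha * (alpha - 1) * f q * (s q)^-1 ^+ 2) * grad_norm2 u G s q.
  rewrite !box_at_hessian hessian_scale_power // metric_traceD !metric_traceZ.
  congr (_ + _ * _); rewrite /metric_trace /grad_norm2 mxE exchange_big /=.
  apply: eq_bigr => b _; rewrite mxE mulr_suml; apply: eq_bigr => a _.
  by rewrite [(_ *m _) a b]mxE big_ord1 ![_^T _ _]mxE; ring.
(* The norm identity eliminates |nu|^2, so that its contributions can be compared with the terms in
   rho. *)
rewrite box_scale (_ : grad_norm2 u G s q = 1 - 2 * rho q * s q); last first.
  by apply/eqP; rewrite eq_sym subr_eq scale_norm.
rewrite !linearZ /=.
have -> : J2P u G (fun r => f r *: A r) q = f q *: J2P u G A q.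
  rewrite /J2P !derivation_actionE [derivation _ (_ *: _)]linearZ /=.
  by rewrite scalerBr !scalerA [_ * f q]mulrC [2 * f q]mulrC.
(* The equation of weight w0 is divided by s to eliminate Delta A. What remains is a comparison of
   coefficients of A, P A, i(nu) d A, nu /\ phi and d phi. *)
have lapE : form_laplacian u G A q = (s q)^-1 *: ((d + 2 * w0 - 2) *:
    (((w0 + k%:R) * rho q) *: A q + nu q (extd u G A q)))
    - (w0 + k%:R) *: J2P u G A q - (d + 2 * w0) *: extd u G phi q.
  rewrite west_eq scalerA mulVf // scale1r.
  by rewrite -addrA -opprD -[X in X - _]addrA addrK.
rewrite lapE /J2P -/f -/(f q).
move: (A q) (schouten_J u G q) (rho q) (derivation_action (G q) _ (A q))
  (nu q (extd u G A q)) (emul _ (phi q)) (extd u G phi q) => a J r PA ndA ep dphi.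
move: (f q) (s q) sq => F t t0; rewrite /alpha dE.
apply/ffunP => S; rewrite !ffunE /GRing.scale /=.
by field.
Qed.

End LocalProca.

(** * The tractor equations, slot by slot, and the reduced system *)

Section ProcaSlots.
Variables (R : realType) (n : nat) (T : topologicalType) (u : chart R n T).
Variables (G : T -> 'M[R]_n.+1) (s : T -> R) (F : slots R n T).
Notation X := (ext_form R n).
Notation inner := (interior_dom u).
Hypothesis Gsmooth : smooth_mx u G.
Hypothesis Gsym : forall q, inner q -> (G q)^T = G q.
Hypothesis Gunit : forall q, inner q -> G q \in unitmx.
Hypothesis spos : forall q, inner q -> 0 < s q.
Hypothesis north0 : forall q, inner q -> north F q = 0.
Hypothesis east0 : forall q, inner q -> east F q = 0.
Variables (k : nat) (w : R).
Implicit Types (p q : T).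
Notation Gi q := (invmx (G q)).
Notation d := (n.+1%:R : R).
Notation nu q := (interior_mul (grad_at u s q *m Gi q)).
Notation rho q := (rho_at u G s q).
Notation A := (west F).
Notation phi := (south F).
Notation h := (d + 2 * w).

Lemma Dop_kernel q : inner q -> let DF := Dop u G k%:Z w F in
  [/\ north DF q = (h - 2) *: ((w + k%:R) *: A q),
      west DF q = (h - 2) *: extd u G A q,
      east DF q = - (2 *: codiff u G A q) + (h * (w + k%:R - 2)) *: phi q &
      south DF q = - (form_laplacian u G A q + (w + k%:R) *: J2P u G A q
                      + h *: extd u G phi q)].
Proof.
move=> Hq DF; split; rewrite /DF /Dop /=.
- by rewrite extd_eq0 // subr0.
- by [].
- rewrite form_laplacian_eq0 // J2P_eq0 ?north0 // scaler0 addr0 add0r.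
  by rewrite (extd_eq0 G east0 Hq) add0r scalerA.
- have Q0 r : inner r -> J2P u G (north F) r = 0 by move=> Hr; rewrite J2P_eq0 ?north0.
  rewrite J2P_eq0 ?(extd_eq0 G north0 Hq) // (extd_eq0 G Q0 Hq).
  by rewrite subrr sub0r -opprD.
Qed.

Lemma nuE q (x : X) : inner q -> imul (G q) (grad_at u s q) x = nu q x.
Proof. by move=> Hq; rewrite imulE // Gsym. Qed.

Lemma Istar_kernel q : inner q -> let IF := Istar u G s F in
  [/\ north IF q = 0, west IF q = nu q (A q) + s q *: phi q, east IF q = 0 &
      south IF q = - nu q (phi q)].
Proof.
move=> Hq IF; rewrite /IF /Istar /= !nuE // north0 // east0 //.
by rewrite !(linear0, scaler0, subr0, add0r, oppr0, sub0r).
Qed.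

Lemma yop_kernel q : inner q -> vanishes_on inner (Istar u G s F) ->
  let DF := Dop u G k%:Z w F in
  [/\ north (yop u G s k%:Z w F) q = nu q (north DF q) + s q *: east DF q,
      west (yop u G s k%:Z w F) q
        = - (rho q *: north DF q + nu q (west DF q) + s q *: south DF q),
      east (yop u G s k%:Z w F) q = - nu q (east DF q) &
      south (yop u G s k%:Z w F) q = - (rho q *: east DF q - nu q (south DF q))].
Proof.
move=> Hq I0 DF; have [z1 z2 z3 z4] := Dop_eq0 Gsym (k%:Z - 1) w I0 Hq.
split.
- transitivity (- north (Istar u G s DF) q).
    by rewrite -[in RHS](addr0 (north (Istar u G s DF) q)) -z1.
  by move: (DF) => D; rewrite /= !nuE // -opprD opprK.
- transitivity (- west (Istar u G s DF) q).
    by rewrite -[in RHS](addr0 (west (Istar u G s DF) q)) -z2.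
  by move: (DF) => D; rewrite /= !nuE //.
- transitivity (- east (Istar u G s DF) q).
    by rewrite -[in RHS](addr0 (east (Istar u G s DF) q)) -z3.
  by move: (DF) => D; rewrite /= !nuE //.
- transitivity (- south (Istar u G s DF) q).
    by rewrite -[in RHS](addr0 (south (Istar u G s DF) q)) -z4.
  by move: (DF) => D; rewrite /= !nuE //.
Qed.

Lemma west_regroup q (a b : X) :
  rho q *: ((h - 2) *: ((w + k%:R) *: a)) + nu q ((h - 2) *: b)
  = (h - 2) *: (((w + k%:R) * rho q) *: a + nu q b).
Proof.
rewrite [nu q (_ *: _)]linearZ scalerDr !scalerA; congr (_ *: _ + _).
by ring.
Qed.

Lemma reduced_proca_of_proca :
  vanishes_on inner (yop u G s k%:Z w F) ->
  vanishes_on inner (Istar u G s F) ->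
  vanishes_on inner (Dhatstar u G k%:Z w F) ->
  reduced_proca u G s k%:R w A phi.
Proof.
move=> y0 I0 D0 q Hq.
have [_ I1 _ I2] := I0 q Hq; have [_ Iw _ Is] := Istar_kernel Hq.
have [_ D1 _ D2] := D0 q Hq.
have nuA : nu q (A q) = - s q *: phi q.
  by rewrite scaleNr; apply/eqP; rewrite -addr_eq0 -Iw I1.
have nuphi : nu q (phi q) = 0 by apply/eqP; rewrite -oppr_eq0 -Is I2.
split=> //.
- by rewrite scaleNr; apply/eqP; rewrite -addr_eq0; apply/eqP; exact: D1.
- by apply/eqP; rewrite -oppr_eq0; apply/eqP; exact: D2.
have [_ yw _ _] := y0 q Hq; have [_ yE _ _] := yop_kernel Hq I0.
have [DN DW _ DS] := Dop_kernel Hq; rewrite DN DW DS yw in yE.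
move/eqP: yE; rewrite eq_sym oppr_eq0 scalerN subr_eq0 => /eqP <-.
by rewrite west_regroup.
Qed.

(** The west slot of y is the last reduced equation. The north and east slots need only the
    equations for i(nu) and delta, and the south slot comes from contracting the last equation with
    nu. *)
Lemma proca_of_reduced_proca : reduced_proca u G s k%:R w A phi ->
  [/\ vanishes_on inner (yop u G s k%:Z w F),
      vanishes_on inner (Istar u G s F),
      vanishes_on inner (Dhatstar u G k%:Z w F) &
      vanishes_on inner (Xstar F)].
Proof.
move=> red.
have I0 : vanishes_on inner (Istar u G s F).
  move=> q Hq; have [nuA nuphi _ _ _] := red q Hq.
  have [-> -> -> ->] := Istar_kernel Hq.
  by rewrite nuA nuphi scaleNr addNr oppr0.
split=> // q Hq; have [nuA nuphi deltaA deltaphi west_eq] := red q Hq; last first.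
- by rewrite /Xstar /= north0 // east0.
- by rewrite /Dhatstar /= deltaA deltaphi scaleNr addNr oppr0.
have sq := s_neq0 spos Hq.
have [-> -> -> ->] := yop_kernel Hq I0.
have [-> -> -> ->] := Dop_kernel Hq.
have west0 : rho q *: ((h - 2) *: ((w + k%:R) *: A q)) + nu q ((h - 2) *: extd u G A q)
    = s q *: (form_laplacian u G A q + (w + k%:R) *: J2P u G A q + h *: extd u G phi q).
  by rewrite west_regroup.
split.
(* Everything is a multiple of s phi, with coefficient 2 (d + 2 w) - 2 h = 0. *)
- rewrite scalerA [nu q (_ *: _)]linearZ /= nuA deltaA.
  by move: (phi q) (s q) => f t; apply/ffunP => S; rewrite !ffunE /GRing.scale /=; ring.
- by rewrite west0 scalerN subrr oppr0.
- by rewrite deltaA scalerA -scaleNr -scalerDl [nu q (_ *: _)]linearZ /= nuphi scaler0 oppr0.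
- have nuZ r x : nu q (r *: x) = r *: nu q x by rewrite linearZ.
  (* Contraction with nu kills i(nu) d A, as i(nu) squares to zero, and turns A into a multiple of
     phi. After division by s this gives i(nu) of the south slot of D. *)
  have nuW : nu q (((w + k%:R) * rho q) *: A q + nu q (extd u G A q))
      = ((w + k%:R) * rho q) *: (- s q *: phi q).
    by rewrite linearD /= interior_mulK addr0 nuZ nuA.
  have := congr1 (nu q) west_eq; rewrite !nuZ nuW.
  move/(congr1 ( *:%R (s q)^-1)); rewrite [RHS]scalerA mulVf // scale1r => nuL.
  rewrite [nu q (- _)]linearN /= opprK -nuL deltaA.
  by move: (phi q) (rho q) (s q) sq => f r t t0; apply/ffunP => S;
    rewrite !ffunE /GRing.scale /=; field.
Qed.

End ProcaSlots.

(** * Critical points in the interior of a chart *)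

Section LocalMinimum.
Variables (R : realType) (n : nat) (T : topologicalType) (u : chart R n T).

Lemma pd_local_min a (f : T -> R) p : smooth_interior u f -> interior_dom u p ->
  (forall q, interior_dom u q -> f p <= f q) -> pd u a f p = 0.
Proof.
move=> fC Hp fmin; rewrite pd_derive //; set x := chart_coord u p; set v := basis_vec R a.
(* With second vector 0 the rectangle degenerates to a segment. It covers non-negative parameters
   only, so v and - v are treated separately to obtain both sides of x. *)
have [t t0 B] := nbhs_rectangle v (0 : 'rV[R]_n.+1) (param_coord_near Hp).
have [t' t'0 B'] := nbhs_rectangle (- v) (0 : 'rV[R]_n.+1) (param_coord_near Hp).
have line r : - t' < r < t -> interior_image u (x + r *: v).
  move=> /andP[r1 r2]; have [r0|r0] := leP 0 r.
    by have := B r 0 _ _; rewrite scale0r addr0; apply; rewrite ?lexx ?r0 ltW.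
  have := B' (- r) 0 _ _; rewrite scale0r addr0 scalerN scaleNr opprK; apply.
    by rewrite oppr_ge0 (ltW r0) lerNl ltW.
  by rewrite lexx ltW.
pose g r : R := f (chart_param u (x + r *: v)).
have dg r : - t' < r < t -> is_derive r 1 g ('D_v (f \o chart_param u) (x + r *: v)).
  move=> /line Hr; apply: (is_derive_line (F := f \o chart_param u)).
  exact: (class_C_derivable (fC 1) Hr).
have t00 : - t' < 0 < t by rewrite oppr_lt0 t'0.
have : is_derive (0 : R) 1 g 0.
  apply: (@derive1_at_min _ g (- t') t 0).
  - by rewrite ltW // (lt_trans _ t0) // oppr_lt0.
  - by move=> r; rewrite in_itv /= => /dg[].
  - by rewrite in_itv.
  move=> r; rewrite in_itv /= => /line/interior_image_param[Hq _].
  rewrite /g scale0r addr0; have [Dp _] := Hp.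
  by rewrite /x chart_coordK //; exact: fmin.
move=> [_ g0]; have [_ g1] := dg 0 t00.
by rewrite -[x]addr0 -[X in x + X](scale0r v) -g1.
Qed.

End LocalMinimum.

Lemma pull_backZ (R : realType) (n : nat) (J : 'M[R]_n.+1) (r : R) (w : ext_form R n) :
  pull_back J (r *: w) = r *: pull_back J w.
Proof.
rewrite /pull_back scaler_sumr; apply: eq_bigr => S _.
by rewrite scalerA ffunE.
Qed.

(** * Poincare-Einstein manifolds *)

Section PoincareEinstein.
Variables (R : realType) (n : nat) (M : manifold R n).
Variables (c : set (two_tensor M)) (sigma : density M).
Hypothesis PE : poincare_einstein c sigma.
Implicit Types (g : two_tensor M) (i : chart_idx M) (p q : point_of M).
Notation inner i := (interior_dom (chart_at M i)).

Lemma sigma_smooth g i : c g -> smooth_interior (chart_at M i) (sigma g).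
Proof.
move=> cg; have [_ [sC _] _ _ _] := PE.
by apply: smooth_at_interior => p [Dp _]; exact: sC.
Qed.

Lemma sigma_pos g p : c g -> ~ boundary p -> 0 < sigma g p.
Proof. by move=> cg; have [_ _ /(_ g cg)[+ _] _ _] := PE; exact. Qed.

Lemma sigma_eq0 g p : c g -> (sigma g p = 0 <-> boundary p).
Proof. by move=> cg; have [_ _ /(_ g cg)[_ +] _ _] := PE; exact. Qed.

(* At a boundary point in the interior of a chart sigma would be minimal,
   contrary to d sigma <> 0. *)
Lemma interior_not_boundary g i p : c g -> inner i p -> ~ boundary p.
Proof.
move=> cg Hp bp; have [_ _ _ /(_ g cg i p) + _] := PE.
have [Dp _] := Hp => /(_ Dp bp)/eqP; apply; apply/rowP => a; rewrite !mxE.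
apply: pd_local_min => //; first exact: sigma_smooth.
move=> q _; rewrite ((sigma_eq0 p cg).2 bp).
have [bq|bq] := pselect (boundary q); first by rewrite ((sigma_eq0 q cg).2 bq).
exact/ltW/sigma_pos.
Qed.

(** [nonzero_region] quantifies over the scales in c, so a scale is required to extract anything
    from it. *)
Lemma conformal_class_nonempty : exists g, c g.
Proof.
have [[g0 _ cP] _ _ _ _] := PE; exists g0; apply/cP; exists (fun=> 1); split => //.
- move=> i p _ _; exists setT, (fun=> 1); split => //; first exact: openT.
  by move=> m; exact: class_C_cst.
- by move=> i p _; rewrite expr1n scale1r.
Qed.

Lemma nonzero_not_boundary p : nonzero_region c sigma p -> ~ boundary p.
Proof.
have [g cg] := conformal_class_nonempty; move=> /(_ g cg)/eqP s0 bp; apply: s0.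
exact/sigma_eq0.
Qed.

(** If the first coordinate were zero in this chart, p would be a boundary point by definition and
    sigma would vanish there. *)
Lemma nonzero_interior i p : (nonzero_region c sigma `&` chart_dom (chart_at M i)) p ->
  inner i p.
Proof.
move=> [/nonzero_not_boundary bp Dp]; split => //.
have [W _ eW] := chart_image_open (chart_at M i).
have : (W `&` half_space (R:=R) (n:=n)) (chart_coord (chart_at M i) p).
  by rewrite -eW; exists p.
move=> [_]; rewrite /half_space /= le_eqVlt => /orP[/eqP x0|//].
by exfalso; apply: bp; exists i.
Qed.

Lemma sigma_interior g i q : c g -> inner i q -> 0 < sigma g q.
Proof. by move=> cg Hq; apply: (sigma_pos cg); exact: interior_not_boundary cg Hq. Qed.

Lemma metric_smooth g i : c g -> smooth_mx (chart_at M i) (g i).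
Proof.
move=> cg; have [[g0 [_ gC _] cP] _ _ _ _] := PE.
have [Om [OC _ gE]] := (cP g).1 cg.
have OmC : smooth_interior (chart_at M i) Om.
  by apply: smooth_at_interior => p [Dp _]; exact: OC.
move=> a b; have g0C : smooth_interior (chart_at M i) (fun q => g0 i q a b).
  by apply: smooth_at_interior => p [Dp _]; exact: gC.
apply: eq_smooth (smoothM (smoothM OmC OmC) g0C) => q [Dq _].
by rewrite gE // mxE.
Qed.

Lemma metric_posdef g i q : c g -> chart_dom (chart_at M i) q ->
  (g i q)^T = g i q /\ forall x : 'rV[R]_n.+1, x != 0 -> 0 < (x *m g i q *m x^T) 0 0.
Proof.
move=> cg Dq; have [[g0 [gP _ _] cP] _ _ _ _] := PE.
have [Om [_ Opos gE]] := (cP g).1 cg; have [gs gp] := gP i q Dq.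
rewrite gE // linearZ /= gs; split => // x x0.
by rewrite -scalemxAr -scalemxAl mxE mulr_gt0 ?exprn_gt0 // gp.
Qed.

Lemma metric_unit g i q : c g -> chart_dom (chart_at M i) q -> g i q \in unitmx.
Proof.
move=> cg Dq; have [_ gp] := metric_posdef cg Dq.
rewrite -row_free_unit -kermx_eq0; apply/eqP/row_matrixP => j; rewrite row0.
apply/eqP/negPn/negP => /gp; rewrite -row_mul mulmx_ker row0 mul0mx mxE.
by rewrite ltxx.
Qed.

Lemma smooth_at_scale_power g i p (r : R) : c g -> inner i p ->
  smooth_at (chart_at M i) (fun q => sigma g q `^ r) p.
Proof.
move=> cg Hp; apply: smooth_interior_at => //; apply: smooth_powR.
  by move=> q Hq; exact: sigma_interior cg Hq.
exact: sigma_smooth.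
Qed.

End PoincareEinstein.

(** * Multiplication of tractor sections by a power of sigma *)

Section ScaledSection.
Variables (R : realType) (n : nat) (M : manifold R n).
Variables (c : set (two_tensor M)) (sigma : density M).
Hypothesis PE : poincare_einstein c sigma.
Notation U := (nonzero_region c sigma).

Lemma is_form_scale g (k : int) (r : R) (w : form_field M) : c g ->
  is_form setT k w -> is_form U k (fun i p => sigma g p `^ r *: w i p).
Proof.
move=> cg [w1 w2 w3]; split.
- by move=> i p S Up Dp Sk; rewrite ffunE w1 // scaler0.
- move=> i p S Up Dp; have Hp : interior_dom (chart_at M i) p.
    exact: (nonzero_interior PE (conj Up Dp)).
  have wC : smooth_interior (chart_at M i) (fun q => w i q S).
    by apply: smooth_at_interior => q [Dq _]; exact: w2.
  have fC : smooth_interior (chart_at M i) (fun q => sigma g q `^ r).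
    by apply: smooth_at_interior => q Hq; exact: (smooth_at_scale_power PE).
  apply: smooth_interior_at => //; apply: eq_smooth (smoothM fC wC) => q _.
  by rewrite ffunE.
- by move=> i j p Up Di Dj; rewrite pull_backZ (w3 i j).
Qed.

(** Since sigma has weight 1, its power contributes the same factor Om^r to all four slots, and the
    transformation law is linear over functions. *)
Lemma tractor_section_scale (k : int) (w r : R) (A : tractor_field M) :
  tractor_section c setT k w A ->
  tractor_section c U k (w + r) (scale_tractor sigma r A).
Proof.
move=> [A1 A2]; split.
  move=> g cg; have [Fn Fw Fe Fs] := A1 g cg.
  by split; apply: is_form_scale.
move=> g gh Om cg cgh gOm i p Up Dp /=.
have [Hn Hw He Hs] := A2 g gh Om cg cgh gOm i p Logic.I Dp.
have [_ Opos _] := gOm; have O0 := Opos p.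
have bp := nonzero_not_boundary PE Up.
have s0 := sigma_pos PE cg bp.
have [_ [_ sconf] _ _ _] := PE.
(* Real powers are multiplicative here because Om and sigma are both positive at p. *)
have sE : sigma gh p `^ r = Om p `^ r * sigma g p `^ r.
  rewrite (sconf g gh Om cg cgh gOm p) powRr1 ?ltW //.
  by rewrite powRM // ltW.
have powE (x : R) : Om p `^ r * Om p `^ (w + x) = Om p `^ (w + r + x).
  by rewrite -powRD ?(lt0r_neq0 O0) ?implybT //; congr (_ `^ _); ring.
have powE2 : Om p `^ r * Om p `^ (w + k%:~R - 2) = Om p `^ (w + r + k%:~R - 2).
  by rewrite -addrA powE addrA.
rewrite Hn Hw He Hs sE -powE2 -powE.
move: (Om p `^ r) (sigma g p `^ r) (Om p `^ (w + k%:~R)) (Om p `^ (w + k%:~R - 2)).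
move=> a b o1 o2.
split.
- by rewrite !scalerA; congr (_ *: _); ring.
- by rewrite [emul _ (_ *: _)]linearZ /= -scalerDr !scalerA; congr (_ *: _); ring.
- by rewrite [imul _ _ (_ *: _)]linearZ /= -scalerBr !scalerA; congr (_ *: _); ring.
have emulZr v t (x : ext_form R n) : emul v (t *: x) = t *: emul v x by rewrite linearZ.
have imulZr G v t (x : ext_form R n) : imul G v (t *: x) = t *: imul G v x by rewrite linearZ.
rewrite !(emulZr, imulZr).
move: (south _ _) (emul _ (east _ _)) (imul _ _ (west _ _)) (emul _ (imul _ _ _))
  (imul _ _ (emul _ _)) => x1 x2 x3 x4 x5.
by apply/ffunP => S; rewrite !ffunE /GRing.scale /=; ring.
Qed.

End ScaledSection.

Theorem theorem5p20 (R : realType) (n : nat) (hn : (2 <= n)%N)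
    (M : manifold R n) (c : set (two_tensor M)) (sigma : density M)
    (k : nat) (w0 : R) (A : tractor_field M)
    (hPE : poincare_einstein c sigma)
    (hw1 : w0 != - k%:R) (hw2 : w0 != k%:R - n%:R)
    (hA : proca_solution c sigma setT k%:Z w0 A) :
  let d : R := n.+1%:R in
  let h0 : R := d + 2 * w0 in
  proca_solution c sigma (nonzero_region c sigma) k%:Z (- w0 - n%:R)
    (scale_tractor sigma (1 - h0) A).
Proof.
move=> d h0; have [Asec Aeq] := hA; split.
  (* The weights of A and of sigma^(1 - h0) add up to - w0 - n because d = n + 1. *)
  have -> : - w0 - n%:R = w0 + (1 - h0) by rewrite /h0 /d -natr1; ring.
  exact: tractor_section_scale.
move=> g cg i u V; have [yA IA DA XA] := Aeq g cg i.
pose G := g i; pose s := sigma g; pose F := A g i.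
have domE q : interior_dom u q -> (setT `&` chart_dom u) q by move=> [Dq _]; split.
have VE q : V q -> interior_dom u q by exact: nonzero_interior.
have Gsmooth : smooth_mx u G by exact: (metric_smooth hPE i cg).
have Gsym q : interior_dom u q -> (G q)^T = G q.
  by move=> [Dq _]; have [] := metric_posdef hPE cg Dq.
have Gunit q : interior_dom u q -> G q \in unitmx.
  by move=> [Dq _]; exact: (metric_unit hPE (g := g) (i := i) cg Dq).
have ssmooth : smooth_interior u s by exact: (sigma_smooth hPE i cg).
have spos q : interior_dom u q -> 0 < s q by move=> Hq; exact: (sigma_interior hPE cg Hq).
(* The Einstein equation is assumed off the boundary only; interior points of a chart qualify by
   [interior_not_boundary]. *)
have ein q : interior_dom u q -> hessian u G s q = - s q *: schouten u G q
    - rho_at u G s q *: G q /\ grad_norm2 u G s q + 2 * rho_at u G s q * s q = 1.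
  move=> Hq; apply: einstein_hessian => //; first exact: s_neq0.
  have [_ _ _ _ /(_ g cg i q)] := hPE; apply; first by have [] := Hq.
  exact: (interior_not_boundary hPE (i := i) cg Hq).
have north0 q : interior_dom u q -> north F q = 0.
  by move=> /domE/XA[_].
have east0 q : interior_dom u q -> east F q = 0.
  by move=> /domE/XA[_ _ _].
have [_ Fw _ Fs] := Asec.1 g cg.
have AC : smooth_form u (west F).
  by move=> S; apply: smooth_at_interior => p [Dp _]; have [_ + _] := Fw; exact.
have phC : smooth_form u (south F).
  by move=> S; apply: smooth_at_interior => p [Dp _]; have [_ + _] := Fs; exact.
have Ak q : interior_dom u q -> forall S : {set 'I_n.+1}, #|S| != k -> west F q S = 0.
  by move=> [Dq _] S Sk; have [+ _ _] := Fw; apply.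
(* The system is transferred on the whole open interior of the chart, where its equations may be
   differentiated, and restricted to V only at the end. *)
have red : reduced_proca u G s k%:R w0 (west F) (south F).
  by apply: reduced_proca_of_proca => // q /domE; [exact: yA|exact: IA|exact: DA].
have redbar := reduced_procaZ Gsmooth Gsym Gunit ssmooth spos
  (fun q Hq => (ein q Hq).1) (fun q Hq => (ein q Hq).2) AC phC Ak red.
have n0 q : interior_dom u q -> north (scale_tractor sigma (1 - h0) A g i) q = 0.
  by move=> Hq; rewrite /= north0 // scaler0.
have e0 q : interior_dom u q -> east (scale_tractor sigma (1 - h0) A g i) q = 0.
  by move=> Hq; rewrite /= east0 // scaler0.
have [y I D X] := proca_of_reduced_proca Gsym spos n0 e0 redbar.
by split=> q /VE; [exact: y|exact: I|exact: D|exact: X].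
Qed.
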